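(* Any isotropic locally conformally flat Lorentzian gradient Ricci soliton $(M,g,f)$ is steady and the underlying manifold $(M,g)$ is locally a $pp$-wave.
   Context: A gradient Ricci soliton is a triple $(M,g,f)$ where $M$ is a manifold of dimension $n+2$, $g$ is a pseudo-Riemannian metric (here Lorentzian) and $f$ is a smooth function on $M$ such that $\operatorname{Hes}_f+\rho=\lambda g$ for some real number $\lambda$, where $\operatorname{Hes}_f(X,Y)=g(\nabla_X\nabla f,Y)$ is the Hessian of $f$ and $\rho$ is the Ricci tensor; it is steady if $\lambda=0$. It is called isotropic if $\|\nabla f\|=0$, where $\|\nabla f\|^2=g(\nabla f,\nabla f)$. A Lorentzian manifold is a $pp$-wave if it admits a parallel null vector field spanning a line field $\mathcal{D}$ such that the curvature tensor satisfies $R(\mathcal{D}^\perp,\mathcal{D}^\perp,\cdot,\cdot)=0$; the general form of an $(n+2)$-dimensional $pp$-wave, $n\ge 1$, is, in coordinates $(u,v,x_1,\dots,x_n)$, $2\,du\,dv+H(u,x_1,\dots,x_n)\,du^2+\sum_{i=1}^n dx_i^2$ with $H$ an arbitrary smooth function.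
   Formalization: The gradient of f is assumed nonzero at some point, and the pp-wave conclusion is stated around points where it is nonzero; with f constant, de Sitter space is isotropic, locally conformally flat and Einstein but neither steady nor a pp-wave. *)

(* Defs.v *)
(* MathComp-Analysis.  Tensors on a manifold are given by their components in
   the charts of a maximal atlas; tangent vectors are row vectors. *)
From HB Require Import structures.
From mathcomp Require Import all_boot all_order all_algebra.
From mathcomp Require Import all_classical all_reals all_analysis.
Set Implicit Arguments.
Unset Strict Implicit.
Unset Printing Implicit Defensive.
Import Order.TTheory GRing.Theory Num.Theory.
Import numFieldNormedType.Exports.
Local Open Scope classical_set_scope.
Local Open Scope ring_scope.

Section Coordinates.
Variables (R : realType) (m : nat).

Definition basis_vec (i : 'I_m) : 'rV[R]_m := delta_mx 0 i.

Definition pderiv (i : 'I_m) (h : 'rV[R]_m -> R) : 'rV[R]_m -> R :=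
  fun x => 'D_(basis_vec i) h x.

(* For open U this is C^oo on U: every iterated partial derivative is
   (Frechet) differentiable, hence continuous, on U. *)
Definition smooth_on (U : set 'rV[R]_m) (h : 'rV[R]_m -> R) : Prop :=
  forall (s : seq 'I_m) x, U x -> differentiable (foldr pderiv h s) x.

Definition smooth_row_on k (U : set 'rV[R]_m) (F : 'rV[R]_m -> 'rV[R]_k) :
  Prop := forall j, smooth_on U (fun x => F x 0 j).

Definition inner (G : 'M[R]_m) (X Y : 'rV[R]_m) : R := (X *m G *m Y^T) 0 0.

Definition minkowski : 'M[R]_m :=
  diag_mx (\row_i (if val i == 0%N then -1 else 1)).

(* The rows of P form an orthonormal basis with one timelike vector. *)
Definition lorentzian (G : 'M[R]_m) : Prop :=
  exists2 P : 'M[R]_m, P \in unitmx & P *m G *m P^T = minkowski.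

Variable G : 'rV[R]_m -> 'M[R]_m.

(* Christoffel symbol Gamma^k_ij of the Levi-Civita connection. *)
Definition christoffel (i j k : 'I_m) (x : 'rV[R]_m) : R :=
  2^-1 * \sum_l invmx (G x) k l *
    (pderiv i (fun y => G y j l) x + pderiv j (fun y => G y i l) x
     - pderiv l (fun y => G y i j) x).

(* covd i X is the covariant derivative of the vector field X along the i-th
   coordinate vector field. *)
Definition covd (i : 'I_m) (X : 'rV[R]_m -> 'rV[R]_m) (x : 'rV[R]_m) :
  'rV[R]_m :=
  \row_k (pderiv i (fun y => X y 0 k) x + \sum_j christoffel i j k x * X x 0 j).

Definition grad (h : 'rV[R]_m -> R) (x : 'rV[R]_m) : 'rV[R]_m :=
  \row_k \sum_l invmx (G x) k l * pderiv l h x.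

Definition hess (h : 'rV[R]_m -> R) (x : 'rV[R]_m) : 'M[R]_m :=
  \matrix_(i, j) inner (G x) (covd i (grad h) x) (basis_vec j).

(* R(X,Y)Z = [nabla_X, nabla_Y] Z - nabla_[X,Y] Z on the coordinate vector
   fields, whose brackets vanish. *)
Definition riem (i j k : 'I_m) (x : 'rV[R]_m) : 'rV[R]_m :=
  covd i (covd j (fun=> basis_vec k)) x - covd j (covd i (fun=> basis_vec k)) x.

Definition curvature (x X Y Z W : 'rV[R]_m) : R :=
  \sum_i \sum_j \sum_k
    X 0 i * Y 0 j * Z 0 k * inner (G x) (riem i j k x) W.

(* rho(X,Y) is the trace of Z |-> R(Z,X)Y. *)
Definition ricci (x : 'rV[R]_m) : 'M[R]_m :=
  \matrix_(j, k) \sum_i riem i j k x 0 i.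

Definition pp_wave_on (U : set 'rV[R]_m) : Prop :=
  exists K : 'rV[R]_m -> 'rV[R]_m,
    [/\ smooth_row_on U K,
        forall x, U x -> K x != 0 /\ inner (G x) (K x) (K x) = 0,
        forall x i, U x -> covd i K x = 0 &
        forall x X Y Z W, U x ->
          inner (G x) X (K x) = 0 -> inner (G x) Y (K x) = 0 ->
          curvature x X Y Z W = 0].

End Coordinates.

(* Only the restrictions of phi to dom and of psi to img matter. *)
Record chart (R : realType) (m : nat) (T : topologicalType) := Chart {
  dom : set T;
  img : set 'rV[R]_m;
  phi : T -> 'rV[R]_m;
  psi : 'rV[R]_m -> T;
  dom_open : open dom;
  img_open : open img;
  phi_img : forall p, dom p -> img (phi p);
  psi_dom : forall x, img x -> dom (psi x);
  phiK : forall p, dom p -> psi (phi p) = p;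
  psiK : forall x, img x -> phi (psi x) = x;
  phi_continuous : forall p, dom p -> {for p, continuous phi};
  psi_continuous : forall x, img x -> {for x, continuous psi} }.

Section Charts.
Variables (R : realType) (m : nat) (T : topologicalType).
Implicit Types c d : chart R m T.

Definition overlap c d : set 'rV[R]_m := [set x | img c x /\ dom d (psi c x)].

Definition transition c d : 'rV[R]_m -> 'rV[R]_m := phi d \o psi c.

Definition compatible c d : Prop :=
  smooth_row_on (overlap c d) (transition c d) /\
  smooth_row_on (overlap d c) (transition d c).

End Charts.

Record manifold (R : realType) (m : nat) := Manifold {
  point_of :> topologicalType;
  manifold_hausdorff : hausdorff_space point_of;
  manifold_countable : @second_countable point_of;
  atlas : set (chart R m point_of);
  atlas_cover : forall p, exists2 c, atlas c & dom c p;
  atlas_compatible : forall c d, atlas c -> atlas d -> compatible c d;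
  atlas_maximal :
    forall c, (forall d, atlas d -> compatible c d) -> atlas c }.

Arguments atlas {R m} M : rename.

(* 'J F x i j is the i-th partial derivative of the j-th component of F. *)
Record lorentz_metric (R : realType) (m : nat) (M : manifold R m) :=
  LorentzMetric {
  metric :> chart R m M -> 'rV[R]_m -> 'M[R]_m;
  metric_smooth : forall c, atlas M c ->
    forall i j, smooth_on (img c) (fun x => metric c x i j);
  metric_sym : forall c, atlas M c ->
    forall x, img c x -> (metric c x)^T = metric c x;
  metric_lorentzian : forall c, atlas M c ->
    forall x, img c x -> lorentzian (metric c x);
  metric_change : forall c d, atlas M c -> atlas M d ->
    forall x, overlap c d x ->
    metric c x = 'J (transition c d) x *m metric d (transition c d x)
                   *m ('J (transition c d) x)^T }.

Section Solitons.
Variables (R : realType) (m : nat) (M : manifold R m).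
Variables (g : lorentz_metric M) (f : M -> R).

(* Around every point there is a chart onto an open set of Minkowski space
   which is conformal. *)
Definition locally_conformally_flat : Prop :=
  forall p : M, exists c : chart R m M, exists sigma : 'rV[R]_m -> R,
    [/\ atlas M c, dom c p, smooth_on (img c) sigma &
        forall x, img c x -> g c x = expR (2 * sigma x) *: minkowski R m].

Definition smooth_fun : Prop :=
  forall c, atlas M c -> smooth_on (img c) (f \o psi c).

Definition gradient_ricci_soliton (lambda : R) : Prop :=
  smooth_fun /\
  forall c, atlas M c -> forall x, img c x ->
    hess (g c) (f \o psi c) x + ricci (g c) x = lambda *: g c x.

Definition isotropic : Prop :=
  forall c, atlas M c -> forall x, img c x ->
    let v := grad (g c) (f \o psi c) x in inner (g c x) v v = 0.

Definition grad_neq0 (p : M) : Prop :=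
  forall c, atlas M c -> dom c p -> grad (g c) (f \o psi c) (phi c p) != 0.

Definition pp_wave_near (p : M) : Prop :=
  exists c : chart R m M,
    [/\ atlas M c, dom c p & pp_wave_on (g c) (img c)].

End Solitons.

(* Main.v *)
Require Import Defs.
From mathcomp Require Import all_boot all_order all_algebra.
From mathcomp Require Import all_classical all_reals all_analysis.
From mathcomp Require Import ring lra.
Set Implicit Arguments.
Unset Strict Implicit.
Unset Printing Implicit Defensive.
Import Order.TTheory GRing.Theory Num.Theory.
Import numFieldNormedType.Exports.
Local Open Scope classical_set_scope.
Local Open Scope ring_scope.

(** The theorem is proved in a conformally flat chart, where the metric is
    [g = w^-2 eta] with [eta] the Minkowski metric and [w = exp (- sigma)].
    Write [df], [dw] for the partial derivatives, [Hf], [Hw] for the matrices of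
    second partial derivatives, [<,>] for the pairing of covectors by [eta], and
    [m = n + 2].  After multiplication by [w] the soliton equation reads

      [(m - 2) Hw + w Hf + dw.df + df.dw + psi eta = 0]

    with a function [psi] that collects the multiples of [eta].  Third partial
    derivatives commute, so that the derivatives of this equation give

      [f_i w_jk - f_k w_ij + psi_k eta_ij - psi_i eta_kj = 0].

    Isotropy says that [df] is null.  In dimension at least 3, where [df] does
    not vanish, plain linear algebra (null_codazzi_structure) then yields
    [Hw = c eta + b df.df] and [dpsi = c df].  The trace of [Hw] and the
    contraction of the soliton equation with [df] (isotropy makes [df] a null
    vector of [Hf]) determine [c = <dw,dw> / (2 w) + lambda / (2 (m - 1) w)] and
    [psi = - <dw,df> - (m - 2) c].  Differentiating this last equality and
    comparing with [dpsi = c df] gives [2 c = <dw,dw> / w], hence [lambda = 0]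
    (soliton_steady).

    With [lambda = 0] both Hessians are explicit (null_structure).  Therefore
    the Schouten tensor of [g] is a multiple of [df.df], the curvature vanishes
    on pairs of vectors orthogonal to the gradient of [f], and
    [nabla_X grad f = - a df(X) grad f] with [a = (m - 2) b / w].  A parallel
    field [phi grad f] requires [dphi = a phi df].  Such a [phi] is found
    without integration: a parallel field would be a conformal Killing field of
    the flat metric [eta], whose components are polynomials of degree at most 2.
    The Taylor polynomial of one of these components, centred at the running
    point [x] and evaluated at the base point [x0], is therefore independent of
    [x].  Since [phi] factors out of the derivatives up to order 2, it is also
    [phi] times a polynomial expression in [w], [dw], [df] and [x - x0], which
    is killing_taylor, and [phi] may be taken to be its inverse;
    killing_taylor_gradient checks directly that killing_taylor has logarithmic
    derivative [- a df].  The neighbourhood on which it does not vanish carries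
    the parallel null field, and the maximal atlas contains the restriction of
    the chart to that neighbourhood. *)

(** * Symmetry of mixed directional derivatives *)

Section MixedPartials.
Variables (R : realType) (V : normedModType R).
Implicit Types (h : V -> R) (x u v z : V).

Lemma is_derive_along_line h u z (s : R) : differentiable h (s *: u + z) ->
  is_derive s 1 (fun r : R => h (r *: u + z)) ('D_u h (s *: u + z)).
Proof.
move=> dh; have eqh : (fun r : R => r^-1 *:
      (((fun r : R => h (r *: u + z)) \o shift s) (r *: 1) - h (s *: u + z))) =
    (fun r : R =>
       r^-1 *: ((h \o shift (s *: u + z)) (r *: u) - h (s *: u + z))).
  apply/funext => r; congr (_ *: (h _ - _)) => /=.
  by rewrite [r *: 1]mulr1 scalerDl addrA.
have /(_ u)dhu := diff_derivable dh.
apply: DeriveDef; first by rewrite /derivable /= eqh; exact: dhu.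
by rewrite /derive /= eqh.
Qed.

(** By the mean value theorem in the direction [u], the second difference is
    [t] times an increment of ['D_u h] in the direction [t *: v], and this
    increment is read off from the differential of ['D_u h] at [x]. *)
Lemma second_difference h x u v :
  (\forall y \near x, differentiable h y) -> differentiable ('D_u h) x ->
  forall e, 0 < e -> \forall t \near 0^'+,
    `|h (x + t *: u + t *: v) - h (x + t *: u) - h (x + t *: v) + h x
      - t ^+ 2 * 'D_v ('D_u h) x| <= e * t ^+ 2.
Proof.
move=> dh dg e e0; set g := 'D_u h in dg *; set L := 'd g x.
(* All points involved are within t * N of x; the error on the differential is
   counted twice and multiplied by t, whence the constant e / (2 * N). *)
set N := `|u| + `|v| + 1.
have N0 : 0 < N by rewrite /N ltr_wpDl // addr_ge0.
have e'0 : 0 < e / (2 * N) by rewrite divr_gt0 // mulr_gt0.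
have [_] := (diff_locallyxP x g).1 dg.
move=> go.
have : (fun k => g (k + x)) = (fun k => g x + L k) +o_ (0 : V) (fun k => k).
  by apply: eqaddoE; apply/funext => k; exact: go.
move=> /eqaddoP /(_ _ e'0) /nbhs_normP [d1 /= d10 go1].
move: dh => /nbhs_normP [d2 /= d20 dh].
near=> t.
have t0 : 0 < t by near: t; exact: nbhs_right_gt.
have tN1 : t * N < d1.
  by rewrite -ltr_pdivlMr//; near: t; apply: nbhs_right_lt; rewrite divr_gt0.
have tN2 : t * N < d2.
  by rewrite -ltr_pdivlMr//; near: t; apply: nbhs_right_lt; rewrite divr_gt0.
have small s r : 0 <= s <= t -> 0 <= r <= t -> `|s *: u + r *: v| <= t * N.
  move=> /andP[s0 st] /andP[r0 rt]; rewrite (le_trans (ler_normD _ _))//.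
  rewrite !normrZ !ger0_norm// /N mulrDr mulr1 mulrDr -[leLHS]addr0.
  by rewrite lerD// ?lerD ?ler_wpM2r// ltW.
have dhs s r : 0 <= s <= t -> 0 <= r <= t ->
  differentiable h (s *: u + (x + r *: v)).
  move=> s0 r0; apply: dh; rewrite /= addrCA opprD addrA subrr sub0r normrN.
  exact: le_lt_trans (small _ _ s0 r0) tN2.
have gs s r : 0 <= s <= t -> 0 <= r <= t ->
    `|g (s *: u + (x + r *: v)) - (g x + L (s *: u + r *: v))| <= e / 2 * t.
  move=> s0 r0; rewrite addrCA addrC.
  have := go1 (s *: u + r *: v); rewrite /= sub0r normrN => go2.
  apply: (le_trans (go2 _)).
    exact: le_lt_trans (small _ _ s0 r0) tN1.
  rewrite (le_trans (ler_wpM2l (ltW e'0) (small _ _ s0 r0)))//.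
  by rewrite le_eqVlt; apply/orP; left; apply/eqP; field; rewrite gt_eqF.
have t00 : 0 <= (0 : R) <= t by apply/andP; split => //; exact: ltW.
have t01 : 0 <= t <= t by apply/andP; split => //; exact: ltW.
pose phi (s : R) := h (s *: u + (x + t *: v)) - h (s *: u + (x + 0 *: v)).
have dphi s : 0 <= s <= t ->
    is_derive s 1 phi (g (s *: u + (x + t *: v)) - g (s *: u + (x + 0 *: v))).
  by move=> st; apply: is_deriveB; apply: is_derive_along_line; apply: dhs.
have dphi' s : s \in `]0, t[%R ->
    is_derive s 1 phi (g (s *: u + (x + t *: v)) - g (s *: u + (x + 0 *: v))).
  by rewrite in_itv /= => /andP[s0 st]; apply: dphi; rewrite !ltW.
have cphi : {within `[0, t], continuous phi}.
  apply: derivable_within_continuous => s; rewrite in_itv /= => st.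
  by case: (dphi s st).
have [xi xit phiE] := MVT t0 dphi' cphi.
have xi0 : 0 <= xi <= t by move: xit; rewrite in_itv /= => /andP[/ltW ->
  /ltW ->].
have -> : 'D_v g x = L v by rewrite /L deriveE.
have -> : h (x + t *: u + t *: v) - h (x + t *: u) - h (x + t *: v) + h x =
    phi t - phi 0.
  rewrite /phi !scale0r !addr0 !add0r addrA [t *: u + x]addrC.
  by rewrite opprB !addrA addrAC.
rewrite phiE subr0.
have := gs _ _ xi0 t01; have := gs _ _ xi0 t00.
have LE s r : L (s *: u + r *: v) = s * L u + r * L v.
  by rewrite /L linearD !linearZ.
rewrite !LE mul0r addr0.
set g1 := g _; set g2 := g (_ + (x + t *: v)) => H1 H2.
have -> : (g2 - g1) * t - t ^+ 2 * L v =
  ((g2 - (g x + (xi * L u + t * L v))) - (g1 - (g x + xi * L u))) * t by ring.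
rewrite normrM (gtr0_norm t0) expr2 mulrA ler_wpM2r ?(ltW t0)//.
rewrite [e]splitr mulrDl.
exact: (le_trans (@ler_normB R R _ _) (lerD H2 H1)).
Unshelve. all: by end_near. Qed.

(** Both mixed derivatives approximate the same second difference, which is
    symmetric in the two directions. *)
Lemma derive_comm h x u v :
  (\forall y \near x, differentiable h y) ->
  differentiable ('D_u h) x -> differentiable ('D_v h) x ->
  'D_v ('D_u h) x = 'D_u ('D_v h) x.
Proof.
move=> dh du dv; apply/eqP; rewrite -subr_eq0 -normr_le0.
apply/ler_addgt0Pr => e e0; rewrite add0r.
have e20 : 0 < e / 2 by rewrite divr_gt0.
have N1 := second_difference v dh du e20.
have N2 := second_difference u dh dv e20.
have [t [[/= t0 H1] H2]] :=
  filter_ex (filterI (filterI (nbhs_right_gt (0 : R)) N1) N2).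
have t20 : 0 < t ^+ 2 by rewrite exprn_gt0.
move: H1 H2; rewrite [x + t *: v + t *: u]addrAC.
move: ('D_v _ x) ('D_u _ x) => A B.
set a := h (x + t *: u + _); set b := h (x + t *: u); set c := h (x + t *: v).
set d := h x => H1 H2.
have AB : `|t ^+ 2 * (A - B)| <= e / 2 * t ^+ 2 + e / 2 * t ^+ 2.
  have -> : t ^+ 2 * (A - B) =
    (a - c - b + d - t ^+ 2 * B) - (a - b - c + d - t ^+ 2 * A) by ring.
  exact: (le_trans (@ler_normB R R _ _) (lerD H2 H1)).
move: AB; rewrite -mulrDl -splitr normrM (gtr0_norm t20) mulrC.
by rewrite (ler_pM2r t20).
Qed.

End MixedPartials.

(** * Calculus of partial derivatives and of smooth functions *)

Lemma near_eq_differentiable (R : numFieldType) (V W : normedModType R) (h k :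
  V -> W) (x : V) :
  {near x, h =1 k} -> differentiable h x -> differentiable k x.
Proof.
move=> hk /diff_locallyP[cd hl].
have kl : k \o shift x = cst (k x) + 'd h x +o_ 0 id.
  move: hl => /eqaddoP hl; apply/eqaddoP => e e0.
  have : \forall y \near 0, (h \o shift x) y = (k \o shift x) y.
    move: hk; rewrite [X in X -> _](near_shift 0 x) subr0; exact: filterS.
  have := hl e e0; apply: filterS2 => y hle hky.
  have -> : (k \o shift x - (cst (k x) + 'd h x)) y =
          (h \o shift x - (cst (h x) + 'd h x)) y.
    by rewrite !fctE (nbhs_singleton hk) -[h (y + x)]/((h \o shift x) y) hky.
  exact: hle.
by apply/diff_locallyP; rewrite (diff_unique cd kl).
Qed.

Section Calculus.
Variables (R : realType) (m : nat).
Implicit Types (U : set 'rV[R]_m) (h k : 'rV[R]_m -> R) (d e : 'I_m -> R).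

(** A relational form of differentiation: the gradient of a compound expression
    is assembled by composing the rules below, and compared afterwards with the
    expected expression through has_gradient_eqd. *)
Definition has_gradient h (x : 'rV[R]_m) d : Prop :=
  differentiable h x /\ forall i, pderiv i h x = d i.

Lemma has_gradient_pderiv h x :
  differentiable h x -> has_gradient h x (fun i => pderiv i h x).
Proof. by []. Qed.

Lemma has_gradient_eqd h x d e :
  has_gradient h x d -> d =1 e -> has_gradient h x e.
Proof. by move=> [dh hd] de; split=> // i; rewrite hd de. Qed.

Lemma has_gradient_eq_on U h k x d : open U -> U x ->
  (forall y, U y -> h y = k y) -> has_gradient h x d -> has_gradient k x d.
Proof.
move=> oU Ux hk [dh hd].
have nhk : \forall y \near x, h y = k y.
  by have := open_nbhs_nbhs (conj oU Ux); apply: filterS => y /hk.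
split; last by move=> i; rewrite -hd /pderiv; apply/esym; exact: near_eq_derive.
exact: near_eq_differentiable nhk dh.
Qed.

Lemma has_gradient_cst (c : R) x : has_gradient (fun=> c) x (fun=> 0).
Proof.
by split=> [|i]; [exact: differentiable_cst | rewrite /pderiv derive_cst].
Qed.

Lemma has_gradientD h k x d e : has_gradient h x d -> has_gradient k x e ->
  has_gradient (fun y => h y + k y) x (fun i => d i + e i).
Proof.
move=> [dh hd] [dk ke]; split=> [|i]; first exact: differentiableD.
by rewrite -hd -ke /pderiv -deriveD //; exact: diff_derivable.
Qed.

Lemma has_gradientM h k x d e : has_gradient h x d -> has_gradient k x e ->
  has_gradient (fun y => h y * k y) x (fun i => d i * k x + h x * e i).
Proof.
move=> [dh hd] [dk ke]; split=> [|i]; first exact: differentiableM.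
rewrite -hd -ke /pderiv [LHS]deriveM; [|exact: diff_derivable..].
by rewrite addrC mulrC.
Qed.

Lemma has_gradientN h x d : has_gradient h x d ->
  has_gradient (fun y => - h y) x (fun i => - d i).
Proof.
move=> [dh hd]; split=> [|i]; first exact: differentiableN.
by rewrite -hd /pderiv -deriveN //; exact: diff_derivable.
Qed.

Lemma has_gradientB h k x d e : has_gradient h x d -> has_gradient k x e ->
  has_gradient (fun y => h y - k y) x (fun i => d i - e i).
Proof. by move=> hd /has_gradientN; exact: has_gradientD. Qed.

Lemma has_gradientV h x d : h x != 0 -> has_gradient h x d ->
  has_gradient (fun y => (h y)^-1) x (fun i => - d i / h x ^+ 2).
Proof.
move=> h0 [dh hd]; split=> [|i]; first exact: differentiableV.
rewrite -hd /pderiv deriveV //; last exact: diff_derivable.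
by rewrite [LHS]mulNr mulNr mulrC.
Qed.

Lemma has_gradient_expR h x d : has_gradient h x d ->
  has_gradient (fun y => expR (h y)) x (fun i => d i * expR (h x)).
Proof.
move=> [dh hd].
have de : differentiable (@expR R) (h x).
  by apply/derivable1_diffP; exact: derivable_expR.
have dc : differentiable (@expR R \o h) x by exact: differentiable_comp.
split=> // i; rewrite -hd /pderiv deriveE // diff_comp //=.
have := diff1E de; rewrite derive1E derive_val => ->.
by rewrite deriveE.
Qed.

Lemma has_gradient_coord (j : 'I_m) x :
  has_gradient (fun y => y 0 j) x (fun i => (i == j)%:R).
Proof.
split=> [|i]; first exact: differentiable_coord.
rewrite /pderiv.
have := derive_mx (M := fun y : 'rV[R]_m => y)
  (@derivable_id _ _ x (basis_vec R i)).
rewrite derive_id => /matrixP/(_ 0 j); rewrite !mxE eqxx /= eq_sym => DE.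
exact: (esym DE).
Qed.

Lemma has_gradient_sum n (h : 'I_n -> 'rV[R]_m -> R) x (d : 'I_n -> 'I_m -> R) :
  (forall l, has_gradient (h l) x (d l)) ->
  has_gradient (fun y => \sum_l h l y) x (fun i => \sum_l d l i).
Proof.
move=> hd; have -> : (fun y => \sum_l h l y) = \sum_l h l.
  by apply/funext => y; rewrite fct_sumE.
split=> [|i]; first by apply: differentiable_sum => l; case: (hd l).
rewrite /pderiv derive_sum; last by move=> l; apply: diff_derivable;
  case: (hd l).
by apply: eq_bigr => l _; case: (hd l) => _; apply.
Qed.

Lemma pderiv_eq_on U h k i : open U -> (forall y, U y -> h y = k y) ->
  forall x, U x -> pderiv i h x = pderiv i k x.
Proof.
move=> oU hk x Ux; apply: near_eq_derive.
by have := open_nbhs_nbhs (conj oU Ux); apply: filterS => y /hk.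
Qed.

Lemma smooth_on_differentiable U h x : smooth_on U h -> U x ->
  differentiable h x.
Proof. by move=> sh; exact: (sh [::]). Qed.

Lemma open_neq0 U h : open U -> smooth_on U h ->
  open (U `&` [set y | h y != 0]).
Proof.
move=> oU sh; rewrite openE => x [Ux hx].
have ch := differentiable_continuous (smooth_on_differentiable sh Ux).
exact: filterI (open_nbhs_nbhs (conj oU Ux)) (cvgr_neq0 (h x) ch hx).
Qed.

Lemma smooth_on_gradient U h x : smooth_on U h -> U x ->
  has_gradient h x (fun i => pderiv i h x).
Proof. by move=> sh Ux; exact: has_gradient_pderiv (smooth_on_differentiable sh
  Ux). Qed.

Lemma smooth_on_pderiv U h i : smooth_on U h -> smooth_on U (pderiv i h).
Proof. by move=> sh s x Ux; have := sh (rcons s i) x Ux;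
  rewrite foldr_rcons. Qed.

Lemma smooth_onS (U W : set 'rV[R]_m) h : W `<=` U -> smooth_on U h ->
  smooth_on W h.
Proof. by move=> WU sh s x /WU; exact: sh. Qed.

Lemma foldr_pderiv_eq_on U h k s : open U -> (forall y, U y -> h y = k y) ->
  forall x, U x -> foldr (@pderiv R m) h s x = foldr (@pderiv R m) k s x.
Proof.
move=> oU hk; elim: s => [|i s IHs] x Ux /=; first exact: hk.
exact: pderiv_eq_on oU IHs _ Ux.
Qed.

Lemma smooth_on_eq U h k : open U -> (forall y, U y -> h y = k y) ->
  smooth_on U h -> smooth_on U k.
Proof.
move=> oU hk sh s x Ux.
by have [] := has_gradient_eq_on oU Ux (foldr_pderiv_eq_on s oU hk)
  (has_gradient_pderiv (sh s x Ux)).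
Qed.

(** Smoothness by coinduction: a class of functions whose partial derivatives
    stay, on [U], in the class consists of smooth functions. *)
Lemma smooth_on_coind U (P : ('rV[R]_m -> R) -> Prop) : open U ->
  (forall h, P h -> exists2 d : 'I_m -> 'rV[R]_m -> R,
     forall i, P (d i) & forall x, U x -> has_gradient h x (d^~ x)) ->
  forall h, P h -> smooth_on U h.
Proof.
move=> oU cP h Ph s; elim/last_ind: s h Ph => [|s i IHs] h Ph x Ux.
  by have [d _ /(_ x Ux)[]] := cP h Ph.
have [d Pd hd] := cP h Ph; rewrite foldr_rcons.
have dE y : U y -> d i y = pderiv i h y by move=> /hd[_ ->].
by have [] := has_gradient_eq_on oU Ux (foldr_pderiv_eq_on s oU dE)
  (has_gradient_pderiv (IHs (d i) (Pd i) x Ux)).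
Qed.

(** The class fed to smooth_on_coind: it is closed under the derivation rules of
    each of its constructors, so that the stability of smoothness under all of
    these operations is obtained at once. *)
Inductive smooth_closure U : ('rV[R]_m -> R) -> Prop :=
| Closure_smooth h : smooth_on U h -> smooth_closure U h
| Closure_add h k : smooth_closure U h -> smooth_closure U k ->
    smooth_closure U (fun y => h y + k y)
| Closure_mul h k : smooth_closure U h -> smooth_closure U k ->
    smooth_closure U (fun y => h y * k y)
| Closure_inv h : smooth_closure U h -> (forall y, U y -> h y != 0) ->
    smooth_closure U (fun y => (h y)^-1)
| Closure_exp h : smooth_closure U h -> smooth_closure U (fun y => expR (h y)).

Lemma smooth_on_cst U (c : R) : smooth_on U (fun=> c).
Proof.
suff cs (s : seq 'I_m) : exists c', foldr (@pderiv R m) (fun=> c) s = fun=> c'.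
  move=> s x _; have [c' ->] := cs s.
  by have [] := has_gradient_cst c' x.
elim: s => [|i s [c' IHs]] /=; first by exists c.
by exists 0; apply/funext => x; rewrite IHs (has_gradient_cst c' x).2.
Qed.

Lemma smooth_closureP U h : open U -> smooth_closure U h -> smooth_on U h.
Proof.
move=> oU; move: h; apply: smooth_on_coind => // h.
have closure_opp k : smooth_closure U k -> smooth_closure U (fun y => - 1 * k
  y).
  exact/Closure_mul/Closure_smooth/smooth_on_cst.
elim=> {h} [h sh|h k ch [d cd hd] ck [e ce he]|h k ch [d cd hd] ck [e ce he]
           |h ch [d cd hd] h0|h ch [d cd hd]].
- exists (fun i => pderiv i h) => [i|x Ux].
    exact/Closure_smooth/smooth_on_pderiv.
  exact: smooth_on_gradient sh Ux.
- exists (fun i y => d i y + e i y) => [i|x Ux]; first exact: Closure_add.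
  by apply: has_gradientD; [exact: hd | exact: he].
- exists (fun i y => d i y * k y + h y * e i y) => [i|x Ux].
    by apply: Closure_add; exact: Closure_mul.
  by apply: has_gradientM; [exact: hd | exact: he].
- exists (fun i y => - 1 * d i y * ((h y)^-1 * (h y)^-1)) => [i|x Ux].
    by apply: Closure_mul; [exact: closure_opp|apply: Closure_mul;
      exact: Closure_inv].
  apply: has_gradient_eqd (has_gradientV (h0 x Ux) (hd x Ux)) _ => i.
  by rewrite mulN1r expr2 invfM.
- exists (fun i y => d i y * expR (h y)) => [i|x Ux].
    by apply: Closure_mul => //; exact: Closure_exp.
  by apply: has_gradient_expR; exact: hd.
Qed.

Lemma smooth_onD U h k : open U -> smooth_on U h -> smooth_on U k ->
  smooth_on U (fun y => h y + k y).
Proof.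
by move=> oU sh sk; apply: smooth_closureP => //; apply: Closure_add;
  exact: Closure_smooth.
Qed.

Lemma smooth_onM U h k : open U -> smooth_on U h -> smooth_on U k ->
  smooth_on U (fun y => h y * k y).
Proof.
by move=> oU sh sk; apply: smooth_closureP => //; apply: Closure_mul;
  exact: Closure_smooth.
Qed.

Lemma smooth_onV U h : open U -> smooth_on U h -> (forall y, U y -> h y != 0) ->
  smooth_on U (fun y => (h y)^-1).
Proof.
by move=> oU sh h0; apply: smooth_closureP => //; apply: Closure_inv => //;
  exact: Closure_smooth.
Qed.

Lemma smooth_on_expR U h : open U -> smooth_on U h ->
  smooth_on U (fun y => expR (h y)).
Proof.
by move=> oU sh; apply: smooth_closureP => //; apply: Closure_exp;
  exact: Closure_smooth.
Qed.

Lemma smooth_onN U h : open U -> smooth_on U h -> smooth_on U (fun y => - h y).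
Proof.
move=> oU sh; apply: (@smooth_on_eq _ (fun y => -1 * h y)) => //.
  by move=> y _; rewrite mulN1r.
by apply: smooth_onM => //; exact: smooth_on_cst.
Qed.

Lemma smooth_onB U h k : open U -> smooth_on U h -> smooth_on U k ->
  smooth_on U (fun y => h y - k y).
Proof. by move=> oU sh sk; apply: smooth_onD => //; exact: smooth_onN. Qed.

Lemma smooth_on_sum U n (h : 'I_n -> 'rV[R]_m -> R) : open U ->
  (forall l, smooth_on U (h l)) -> smooth_on U (fun y => \sum_l h l y).
Proof.
move=> oU; elim: n h => [|n IHn] h sh.
  apply: (@smooth_on_eq _ (fun=> 0)) => // [y _|]; last exact: smooth_on_cst.
  by rewrite big_ord0.
apply: (@smooth_on_eq _ (fun y => h ord0 y + \sum_l h (lift ord0 l) y)) => //.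
  by move=> y _; rewrite big_ord_recl.
by apply: smooth_onD => //; exact: IHn.
Qed.

Lemma smooth_on_coord U (j : 'I_m) : open U -> smooth_on U (fun y => y 0 j).
Proof.
move=> oU s x Ux; case/lastP: s => [|s i]; first exact: differentiable_coord.
rewrite foldr_rcons.
have -> : pderiv i (fun y : 'rV[R]_m => y 0 j) = fun=> (i == j)%:R.
  by apply/funext => y; case: (has_gradient_coord j y).
by apply: smooth_on_cst Ux.
Qed.

(** Smoothness on an open set makes the first derivatives differentiable near
    the point, as the symmetry of mixed derivatives requires. *)
Lemma pderiv_comm U h x i j : open U -> smooth_on U h -> U x ->
  pderiv i (pderiv j h) x = pderiv j (pderiv i h) x.
Proof.
move=> oU sh Ux; apply: derive_comm.
- by have := open_nbhs_nbhs (conj oU Ux); apply: filterS => y;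
  exact: smooth_on_differentiable.
- exact: smooth_on_differentiable (smooth_on_pderiv j sh) Ux.
- exact: smooth_on_differentiable (smooth_on_pderiv i sh) Ux.
Qed.

End Calculus.

(** * Null solutions of an algebraic Codazzi equation *)

(** The signature of the flat metric only enters through the squares of the
    diagonal entries [eps], so that this part is about any diagonal metric with
    entries of square 1. *)
Section Pairing.
Variables (R : realType) (m : nat) (eps : 'I_m -> R).
Hypothesis eps2 : forall i, eps i * eps i = 1.
Implicit Types (u v : 'I_m -> R) (h : 'rV[R]_m -> R).

Definition eta (i j : 'I_m) : R := eps i * (i == j)%:R.

Definition dot u v : R := \sum_i eps i * u i * v i.

(** First and second partial derivatives as families of components: [dif] and
    [hes] are not corrected by Christoffel symbols. *)
Definition dif h x : 'I_m -> R := fun i => pderiv i h x.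

Definition hes h x : 'I_m -> 'I_m -> R := fun i j => pderiv i (pderiv j h) x.

Definition lap h x := \sum_i eps i * hes h x i i.

Lemma etaC i j : eta i j = eta j i.
Proof. by rewrite /eta eq_sym; case: eqP => [->|_]; rewrite ?mulr0. Qed.

Lemma sum_delta u i : \sum_j u j * (j == i)%:R = u i.
Proof.
rewrite (bigD1 i) //= eqxx mulr1 big1 ?addr0 // => j /negPf ->.
by rewrite mulr0.
Qed.

Lemma dot_eta u j : dot u (eta^~ j) = u j.
Proof.
rewrite -[RHS]sum_delta; apply: eq_bigr => i _; rewrite /eta.
by rewrite mulrACA eps2 mul1r.
Qed.

Lemma dotC u v : dot u v = dot v u.
Proof. by apply: eq_bigr => i _; rewrite mulrAC. Qed.

Lemma trace_eta : \sum_i eps i * eta i i = m%:R.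
Proof.
rewrite (eq_bigr (fun=> 1)) => [|i _]; first by rewrite sumr_const card_ord.
by rewrite /eta eqxx mulr1 eps2.
Qed.

(** Contracting the equation with [F] gives
    [Psi_k F_j = F_k v_j + s eta_kj] with [v = A F] and [s = <Psi,F>].  The
      trace
    of this identity and its contraction with [F] give two values of [<F,v>],
    namely [s - m s] and [- s]; they agree only if [s = 0], because [m] is not
      2.
    Then [Psi] and [v] are proportional to [F], and the original equation says
    that [A - c eta] has all its rows proportional to [F]. *)
Lemma null_codazzi_structure (F Psi : 'I_m -> R) (A : 'I_m -> 'I_m -> R) i0 :
  (2 < m)%N -> F i0 != 0 -> dot F F = 0 ->
  (forall i j, A i j = A j i) ->
  (forall i j k, F i * A j k - F k * A i j + Psi k * eta i j - Psi i * eta k j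
     = 0) ->
  exists c b, (forall i j, A i j = c * eta i j + b * F i * F j) /\
    (forall k, Psi k = c * F k).
Proof.
move=> m2 F0 FF Asym codazzi.
pose v j := dot F (A^~ j); have [s sE] : exists s, s = dot Psi F by exists (dot
  Psi F).
have contracted k j : Psi k * F j = F k * v j + s * eta k j.
  have : \sum_i eps i * F i * (F i * A j k - F k * A i j + Psi k * eta i j
      - Psi i * eta k j) = 0.
    by rewrite big1 // => i _; rewrite codazzi mulr0.
  have -> : \sum_i eps i * F i * (F i * A j k - F k * A i j + Psi k * eta i j
      - Psi i * eta k j) =
    dot F F * A j k - F k * v j + Psi k * dot F (eta^~ j) - s * eta k j.
    rewrite /v sE /dot !(mulr_suml, mulr_sumr) -!sumrN -!big_split /=.
    by apply: eq_bigr => i _; ring.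
  by rewrite FF dot_eta => H; lra.
have Fv : dot F v = s - s * m%:R.
  have : s = \sum_j eps j * (F j * v j + s * eta j j).
    by rewrite {1}sE; apply: eq_bigr => j _; rewrite -contracted mulrA.
  have -> : \sum_j eps j * (F j * v j + s * eta j j) = dot F v + s * m%:R.
    rewrite -trace_eta mulr_sumr -big_split; apply: eq_bigr => j _ /=; ring.
  by move=> E; lra.
have Fv' : dot F v = - s.
  have : \sum_j eps j * F j * (Psi i0 * F j) =
         \sum_j eps j * F j * (F i0 * v j + s * eta i0 j).
    by apply: eq_bigr => j _; rewrite contracted.
  have -> : \sum_j eps j * F j * (Psi i0 * F j) = Psi i0 * dot F F.
    by rewrite mulr_sumr; apply: eq_bigr => j _; ring.
  have -> : \sum_j eps j * F j * (F i0 * v j + s * eta i0 j) =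
    F i0 * dot F v + s * dot F (eta^~ i0).
    rewrite !mulr_sumr -big_split /=; apply: eq_bigr => j _.
    by rewrite [eta i0 j]etaC; ring.
  rewrite FF dot_eta mulr0 [s * _]mulrC -mulrDr => /esym/eqP.
  by rewrite mulf_eq0 (negPf F0) /= addr_eq0 => /eqP.
have s0 : s = 0.
  have : s * (m%:R - 2) = 0 by rewrite mulrBr; lra.
  move/eqP; rewrite mulf_eq0 subr_eq0 => /orP[/eqP //|].
  by rewrite (eqr_nat R m 2) => /eqP m2'; rewrite m2' in m2.
pose c := Psi i0 / F i0.
have vE j : v j = c * F j.
  by have := contracted i0 j; rewrite s0 mul0r addr0 /c mulrAC => ->;
    rewrite mulrC mulrA mulVf ?mul1r.
have PsiE k : Psi k = c * F k.
  have := contracted k i0; rewrite s0 mul0r addr0 vE => E.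
  by apply: (mulIf F0); rewrite E; ring.
exists c, ((A i0 i0 - c * eta i0 i0) / F i0 ^+ 2); split=> // i j.
have E1 := codazzi i0 j i; have E2 := codazzi i0 i0 j.
rewrite !PsiE in E1 E2.
have E1' : F i0 * (A i j - c * eta i j) = F i * (A j i0 - c * eta j i0).
  rewrite [A i j]Asym [A j i0]Asym [eta j i0]etaC; lra.
have E2' : F i0 * (A j i0 - c * eta j i0) = F j * (A i0 i0 - c * eta i0 i0).
  rewrite [A j i0]Asym; lra.
have E3 : F i0 ^+ 2 * (A i j - c * eta i j) =
    F i * (F j * (A i0 i0 - c * eta i0 i0)).
  by rewrite expr2 -[LHS]mulrA E1' mulrCA E2'.
have {1}-> : A i j = c * eta i j + F i0 ^+ 2 * (A i j - c * eta i j) / F i0 ^+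
  2.
  by field.
by rewrite E3; field.
Qed.

Lemma has_gradient_dot (u v : 'I_m -> 'rV[R]_m -> R) (du dv : 'I_m -> 'I_m ->
  R) x :
  (forall l, has_gradient (u l) x (du l)) ->
  (forall l, has_gradient (v l) x (dv l)) ->
  has_gradient (fun y => dot (u^~ y) (v^~ y)) x
    (fun i => dot (du^~ i) (v^~ x) + dot (u^~ x) (dv^~ i)).
Proof.
move=> hu hv.
have hl l : has_gradient (fun y => eps l * u l y * v l y) x
    (fun i => eps l * du l i * v l x + eps l * u l x * dv l i).
  have Hu := hu l; have Hv := hv l.
  apply: has_gradient_eqd
    (has_gradientM (has_gradientM (has_gradient_cst (eps l) x) Hu) Hv) _.
  by move=> i /=; ring.
apply: has_gradient_eqd (has_gradient_sum hl) _ => i.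
by rewrite /dot -big_split.
Qed.

End Pairing.

(** Replacing the derivatives by variables before [ring] and [field] keeps these
    tactics from comparing them up to unfolding. *)
Ltac generalize_atoms := repeat match goal with
  | |- context [dot ?e ?u ?v] => generalize (dot e u v); intro
  | |- context [lap ?e ?h ?x] => generalize (lap e h x); intro
  | |- context [hes ?h ?x ?i ?j] => generalize (hes h x i j); intro
  | |- context [dif ?h ?x ?i] => generalize (dif h x i); intro
  | |- context [eta ?e ?i ?j] => generalize (eta e i j); intro
  end.

(** * Hessians of the conformal factor and a Taylor polynomial *)

Section Structure.
Variables (R : realType) (m : nat) (eps : 'I_m -> R).
Hypothesis eps2 : forall i, eps i * eps i = 1.
Variables (U : set 'rV[R]_m) (w f : 'rV[R]_m -> R).
Hypotheses (oU : open U) (smooth_w : smooth_on U w) (smooth_f : smooth_on U f).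
Hypothesis w0 : forall x, U x -> w x != 0.

Local Notation eta := (eta eps).
Local Notation dot := (dot eps).
Local Notation lap := (lap eps).

Lemma dif_gradient h x : smooth_on U h -> U x -> has_gradient h x (dif h x).
Proof. exact: smooth_on_gradient. Qed.

Lemma hes_gradient h x j : smooth_on U h -> U x ->
  has_gradient (fun y => dif h y j) x (fun i => hes h x i j).
Proof. by move=> sh; exact/smooth_on_gradient/smooth_on_pderiv. Qed.

Lemma hesC h x i j : smooth_on U h -> U x -> hes h x i j = hes h x j i.
Proof. by move=> sh; exact: pderiv_comm oU sh. Qed.

Lemma dot_dif_gradient h k x : smooth_on U h -> smooth_on U k -> U x ->
  has_gradient (fun y => dot (dif h y) (dif k y)) x
    (fun i => dot (hes h x i) (dif k x) + dot (dif h x) (hes k x i)).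
Proof. by move=> sh sk Ux; apply: has_gradient_dot => l;
  exact: hes_gradient. Qed.

Lemma smooth_dif h j : smooth_on U h -> smooth_on U (fun y => dif h y j).
Proof. exact: smooth_on_pderiv. Qed.

Lemma smooth_hes h i j : smooth_on U h -> smooth_on U (fun y => hes h y i j).
Proof. by move=> sh; exact/smooth_on_pderiv/smooth_on_pderiv. Qed.

Lemma smooth_dot h k : smooth_on U h -> smooth_on U k ->
  smooth_on U (fun y => dot (dif h y) (dif k y)).
Proof.
move=> sh sk; apply: smooth_on_sum => // l; apply: smooth_onM => //.
  by apply: smooth_onM => //; [exact: smooth_on_cst | exact: smooth_dif].
exact: smooth_dif.
Qed.

Lemma smooth_lap h : smooth_on U h -> smooth_on U (lap h).
Proof.
move=> sh; apply: smooth_on_sum => // l; apply: smooth_onM => //.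
  exact: smooth_on_cst.
exact: smooth_hes.
Qed.

Lemma has_gradient_unique (h : 'rV[R]_m -> R) x d e :
  has_gradient h x d -> has_gradient h x e -> d =1 e.
Proof. by move=> [_ hd] [_ he] i; rewrite -hd he. Qed.

(** When [lambda = 0] this is the coefficient of [eta] in the Hessian of [w];
    it is the value that makes the trace of the Schouten tensor vanish. *)
Definition hess_coef x := dot (dif w x) (dif w x) / (2 * w x).

(** The form that the soliton equation imposes on the flat Hessians of [w] and
    [f].  The last equality says that the Hessian of [f] for the metric
    [w^-2 eta] is [- (m - 2) b / w] times [df.df]. *)
Definition null_structure x c b : Prop :=
  [/\ dot (dif f x) (dif f x) = 0,
      forall i j, hes w x i j = c * eta i j + b * dif f x i * dif f x j &
      forall i j, hes f x i j =
        (dot (dif w x) (dif f x) * eta i j - dif w x i * dif f x j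
           - dif w x j * dif f x i) / w x
        - (m%:R - 2) * b / w x * dif f x i * dif f x j].

Lemma dot_eta_comb u v z i a b c :
  dot u (fun j => a * eta i j + b * v j + c * z j) =
  a * u i + b * dot u v + c * dot u z.
Proof.
rewrite -[u i in RHS](dot_eta eps2) /dot !mulr_sumr -!big_split.
by apply: eq_bigr => j _ /=; rewrite [eta i j]etaC; ring.
Qed.

Section AtPoint.
Variables (x : 'rV[R]_m) (c b : R).
Hypotheses (Ux : U x) (structure_x : null_structure x c b).

Lemma dot_hes_w u i :
  dot u (hes w x i) = c * u i + b * dif f x i * dot u (dif f x).
Proof.
case: structure_x => _ wE _.
have := dot_eta_comb u (dif f x) (dif f x) i c (b * dif f x i) 0.
rewrite mul0r addr0 => <-; congr (dot u _); apply/funext => j.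
by rewrite wE mul0r addr0.
Qed.

Lemma dot_hes_f u i : dot u (hes f x i) =
  dot (dif w x) (dif f x) / w x * u i
  + (- dif w x i / w x - (m%:R - 2) * b / w x * dif f x i) * dot u (dif f x)
  + (- dif f x i / w x) * dot u (dif w x).
Proof.
case: structure_x => _ _ fE; rewrite -dot_eta_comb; congr (dot u _).
apply/funext => j; rewrite fE; move: (w0 Ux) => wx; generalize_atoms; field.
exact: wx.
Qed.

(** Only first derivatives are differentiated here and in the rules below, so
    that [c] and [b] are mere numbers attached to the point [x]. *)
Lemma dot_dif_wf_gradient : has_gradient (fun y => dot (dif w y) (dif f y)) x
  (fun i => (c - 2 * hess_coef x
             - (m%:R - 2) * b / w x * dot (dif w x) (dif f x)) * dif f x i).
Proof.
have [ff _ _] := structure_x; have wx := w0 Ux.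
apply: has_gradient_eqd (dot_dif_gradient smooth_w smooth_f Ux) _ => i.
rewrite [dot (hes w x i) _]dotC dot_hes_w dot_hes_f ff /hess_coef;
  generalize_atoms.
by field.
Qed.

Lemma hess_coef_gradient : has_gradient hess_coef x
  (fun i => ((c - hess_coef x) * dif w x i
             + b * dot (dif w x) (dif f x) * dif f x i) / w x).
Proof.
have wx := w0 Ux; have gw := dif_gradient smooth_w Ux.
have w20 : 2 * w x != 0 by rewrite mulf_neq0.
apply: has_gradient_eqd (has_gradientM (dot_dif_gradient smooth_w smooth_w Ux)
  (has_gradientV w20 (has_gradientM (has_gradient_cst 2 x) gw))) _ => i.
rewrite [dot (hes w x i) _]dotC dot_hes_w /hess_coef; generalize_atoms.
by field.
Qed.

End AtPoint.

(** For a function [phi] with [dphi = a phi df] the covector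
    [phi w^2 df], obtained by lowering with [eta] the index of the field
    [phi grad f], is a conformal Killing covector of [eta].  Its component [j]
    is [phi w^2 f_j]; the first derivatives of this component are
    [phi * killing_d1], and the second ones are [phi] times
    [eta_lj s_i + eta_ij s_l - eta_li s_j] with [s = killing_d2]; finally
    [phi s] is constant. *)
Section KillingTaylor.
Variables (x0 : 'rV[R]_m) (j : 'I_m).

Definition killing_d1 y i : R :=
  w y * (dif w y i * dif f y j - dif w y j * dif f y i
         + dot (dif w y) (dif f y) * eta i j).

Definition killing_d2 y i : R :=
  dot (dif w y) (dif f y) * dif w y i - hess_coef y * w y * dif f y i.

Definition offset (y : 'rV[R]_m) i : R := y 0 i - x0 0 i.

(** The Taylor polynomial at [x0], centred at [y], of the component [j], with
    [phi] factored out; the displacement is [- offset y].  For [phi] as above,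
    [phi * killing_taylor] is constant. *)
Definition killing_taylor y : R :=
  w y * w y * dif f y j - \sum_i offset y i * killing_d1 y i
  + eps j * offset y j * (\sum_i offset y i * killing_d2 y i)
  - 2^-1 * (dot (offset y) (offset y) * killing_d2 y j).

Variables (x : 'rV[R]_m) (b : R).
Hypotheses (Ux : U x) (structure_x : null_structure x (hess_coef x) b).

Let a := (m%:R - 2) * b / w x.

Lemma killing_d2_gradient i : has_gradient (fun y => killing_d2 y i) x
  (fun l => - a * dif f x l * killing_d2 x i).
Proof.
have [_ wE fE] := structure_x; have wx := w0 Ux.
have gw := dif_gradient smooth_w Ux.
have gwi := hes_gradient i smooth_w Ux; have gfi := hes_gradient i smooth_f Ux.
have gt := dot_dif_wf_gradient Ux structure_x.
have gq := hess_coef_gradient Ux structure_x.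
apply: has_gradient_eqd (has_gradientB (has_gradientM gt gwi)
  (has_gradientM (has_gradientM gq gw) gfi)) _ => l.
rewrite wE fE /killing_d2 /a; cbv beta.
move: (hess_coef x) => q; generalize_atoms; by field.
Qed.

Lemma killing_d1_gradient i : has_gradient (fun y => killing_d1 y i) x
  (fun l => - a * dif f x l * killing_d1 x i
    + (eta l j * killing_d2 x i + eta i j * killing_d2 x l - eta l i *
      killing_d2 x j)).
Proof.
have [_ wE fE] := structure_x; have wx := w0 Ux.
have gw := dif_gradient smooth_w Ux.
have gwi l := hes_gradient l smooth_w Ux; have gfi l := hes_gradient l smooth_f
  Ux.
have gt := dot_dif_wf_gradient Ux structure_x.
apply: has_gradient_eqd (has_gradientM gw (has_gradientD (has_gradientB
  (has_gradientM (gwi i) (gfi j)) (has_gradientM (gwi j) (gfi i)))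
  (has_gradientM gt (has_gradient_cst (eta i j) x)))) _ => l.
rewrite !wE !fE /killing_d2 /killing_d1 /a; cbv beta.
move: (hess_coef x) => q; generalize_atoms; by field.
Qed.

Lemma offset_gradient i : has_gradient (fun y => offset y i) x (fun l => (l ==
  i)%:R).
Proof.
apply: has_gradient_eqd
  (has_gradientB (has_gradient_coord i x) (has_gradient_cst (x0 0 i) x)) _ => l.
by rewrite subr0.
Qed.

(** Each of the families [w^2 df], [killing_d1], [killing_d2] satisfies
    [d_l k = - a f_l k + (next derivative)]; differentiating the offsets in the
    Taylor polynomial cancels all the terms with the next derivatives. *)
Lemma killing_taylor_gradient :
  has_gradient killing_taylor x (fun l => - a * dif f x l * killing_taylor x).
Proof.
have gw := dif_gradient smooth_w Ux; have gf := hes_gradient j smooth_f Ux.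
have [_ _ fE] := structure_x; have wx := w0 Ux.
have gK : has_gradient (fun y => w y * w y * dif f y j) x
    (fun l => - a * dif f x l * (w x * w x * dif f x j) + killing_d1 x l).
  apply: has_gradient_eqd (has_gradientM (has_gradientM gw gw) gf) _ => l.
  rewrite fE /killing_d1 /a; generalize_atoms; by field.
have gT : has_gradient (fun y => \sum_i offset y i * killing_d1 y i) x
    (fun l => killing_d1 x l - a * dif f x l * (\sum_i offset x i * killing_d1
      x i)
       + eta l j * (\sum_i offset x i * killing_d2 x i)
       + eps j * offset x j * killing_d2 x l - eps l * offset x l * killing_d2
         x j).
  apply: has_gradient_eqd (has_gradient_sum (fun i =>
    has_gradientM (offset_gradient i) (killing_d1_gradient i))) _ => l.
  rewrite -[X in _ = X - _ + _ + _ - _](sum_delta (killing_d1 x) l).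
  rewrite -[X in _ = _ + eps j * X * _ - _](sum_delta (offset x) j).
  rewrite -[X in _ = _ - eps l * X * _](sum_delta (offset x) l).
  rewrite !(mulr_sumr, mulr_suml) -!sumrN -!big_split; apply: eq_bigr => i _ /=.
  rewrite [eta l i]etaC /eta [l == i]eq_sym.
  rewrite [eps i * (i == j)%:R](_ : _ = eps j * (i == j)%:R); last first.
    by case: eqP => [->//|]; rewrite !mulr0.
  rewrite [eps i * (i == l)%:R](_ : _ = eps l * (i == l)%:R); last first.
    by case: eqP => [->//|]; rewrite !mulr0.
  by generalize_atoms; ring.
have gS : has_gradient (fun y => \sum_i offset y i * killing_d2 y i) x
    (fun l => killing_d2 x l - a * dif f x l * (\sum_i offset x i * killing_d2
      x i)).
  apply: has_gradient_eqd (has_gradient_sum (fun i =>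
    has_gradientM (offset_gradient i) (killing_d2_gradient i))) _ => l.
  rewrite -[X in _ = X - _](sum_delta (killing_d2 x) l).
  rewrite mulr_sumr -sumrN -big_split; apply: eq_bigr => i _ /=.
  by rewrite [l == i]eq_sym; generalize_atoms; ring.
have gN : has_gradient (fun y => dot (offset y) (offset y)) x
    (fun l => 2 * (eps l * offset x l)).
  apply: has_gradient_eqd (has_gradient_dot eps offset_gradient
    offset_gradient) _ => l.
  rewrite -[RHS](sum_delta (fun i => 2 * (eps i * offset x i)) l) /dot
    -big_split.
  by apply: eq_bigr => i _ /=; rewrite [l == i]eq_sym; ring.
apply: has_gradient_eqd (has_gradientB (has_gradientD (has_gradientB gK gT)
  (has_gradientM (has_gradientM (has_gradient_cst (eps j) x) (offset_gradient
    j))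
     gS)) (has_gradientM (has_gradient_cst 2^-1 x)
  (has_gradientM gN (killing_d2_gradient j)))) _ => l.
rewrite /killing_taylor [eta l j]etaC /eta [j == l]eq_sym; cbv beta.
set S1 := \sum_i _; set S2 := \sum_i _.
by generalize_atoms; field.
Qed.

End KillingTaylor.

End Structure.

(** * The soliton equation in a conformally flat chart *)

Section SolitonEquation.
Variables (R : realType) (m : nat) (eps : 'I_m -> R).
Hypothesis eps2 : forall i, eps i * eps i = 1.
Variables (U : set 'rV[R]_m) (w f : 'rV[R]_m -> R) (lambda : R).
Hypotheses (m2 : (2 < m)%N) (oU : open U).
Hypotheses (smooth_w : smooth_on U w) (smooth_f : smooth_on U f).
Hypothesis w0 : forall x, U x -> w x != 0.

Local Notation eta := (eta eps).
Local Notation dot := (dot eps).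
Local Notation lap := (lap eps).

(** The coefficient of [eta] in the soliton equation multiplied by [w]. *)
Definition pure_trace x := lap w x - (m%:R - 1) * dot (dif w x) (dif w x) / w x
  - dot (dif w x) (dif f x) - lambda / w x.

Lemma smooth_pure_trace : smooth_on U pure_trace.
Proof.
have sv := smooth_onV oU smooth_w w0; have sc := @smooth_on_cst R m U.
have sl := smooth_lap eps oU smooth_w.
rewrite /pure_trace; apply: smooth_onB => //; last exact: smooth_onM.
apply: smooth_onB => //; last exact: smooth_dot.
apply: smooth_onB => //; apply: smooth_onM => //; apply: smooth_onM => //.
exact: smooth_dot.
Qed.

Hypothesis soliton : forall x, U x -> forall i j,
  (m%:R - 2) * hes w x i j / w x
  + (lap w x / w x - (m%:R - 1) * dot (dif w x) (dif w x) / w x ^+ 2) * eta i j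
  + (hes f x i j + (dif w x i * dif f x j + dif w x j * dif f x i
       - dot (dif w x) (dif f x) * eta i j) / w x)
  = lambda / w x ^+ 2 * eta i j.
Hypothesis null : forall x, U x -> dot (dif f x) (dif f x) = 0.

Lemma cleared_soliton x i j : U x ->
  (m%:R - 2) * hes w x i j + w x * hes f x i j
  + (dif w x i * dif f x j + dif w x j * dif f x i)
  + pure_trace x * eta i j = 0.
Proof.
move=> Ux; have wx := w0 Ux.
transitivity (w x * ((m%:R - 2) * hes w x i j / w x
  + (lap w x / w x - (m%:R - 1) * dot (dif w x) (dif w x) / w x ^+ 2) * eta i j
  + (hes f x i j + (dif w x i * dif f x j + dif w x j * dif f x i
       - dot (dif w x) (dif f x) * eta i j) / w x)
  - lambda / w x ^+ 2 * eta i j)).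
  by rewrite /pure_trace; generalize_atoms; field.
by rewrite soliton // subrr mulr0.
Qed.

(** Antisymmetrising the derivative of cleared_soliton in two indices removes
  the
    third derivatives and all the terms with the Hessian of [f]. *)
Lemma soliton_codazzi x : U x -> forall i j k,
  dif f x i * hes w x j k - dif f x k * hes w x i j
  + dif pure_trace x k * eta i j - dif pure_trace x i * eta k j = 0.
Proof.
move=> Ux.
have gw := dif_gradient smooth_w Ux.
have gp := dif_gradient smooth_pure_trace Ux.
have gdw j := hes_gradient j smooth_w Ux.
have gdf j := hes_gradient j smooth_f Ux.
have ghw i j : has_gradient (fun y => hes w y i j) x
    (fun k => hes (pderiv j w) x k i).
  exact: hes_gradient (smooth_on_pderiv j smooth_w) Ux.
have ghf i j : has_gradient (fun y => hes f y i j) x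
    (fun k => hes (pderiv j f) x k i).
  exact: hes_gradient (smooth_on_pderiv j smooth_f) Ux.
have D i j k : (m%:R - 2) * hes (pderiv j w) x k i
    + (dif w x k * hes f x i j + w x * hes (pderiv j f) x k i)
    + (hes w x k i * dif f x j + dif w x i * hes f x k j
       + (hes w x k j * dif f x i + dif w x j * hes f x k i))
    + dif pure_trace x k * eta i j = 0.
  pose S y := (m%:R - 2) * hes w y i j + w y * hes f y i j
      + (dif w y i * dif f y j + dif w y j * dif f y i) + pure_trace y * eta i
        j.
  have gS0 : has_gradient S x (fun=> 0).
    apply: (has_gradient_eq_on oU Ux _ (has_gradient_cst 0 x)) => y Uy.
    by rewrite /S cleared_soliton.
  have gS : has_gradient S x (fun k => (m%:R - 2) * hes (pderiv j w) x k i
      + (dif w x k * hes f x i j + w x * hes (pderiv j f) x k i)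
      + (hes w x k i * dif f x j + dif w x i * hes f x k j
         + (hes w x k j * dif f x i + dif w x j * hes f x k i))
      + dif pure_trace x k * eta i j).
    apply: has_gradient_eqd (has_gradientD (has_gradientD (has_gradientD
      (has_gradientM (has_gradient_cst _ x) (ghw i j))
      (has_gradientM gw (ghf i j)))
      (has_gradientD (has_gradientM (gdw i) (gdf j))
                     (has_gradientM (gdw j) (gdf i))))
      (has_gradientM gp (has_gradient_cst _ x))) _.
    by move=> l; cbv beta; generalize_atoms; ring.
  exact: has_gradient_unique gS gS0 k.
move=> i j k; have := D k j i; have := D i j k.
rewrite (hesC oU i k (smooth_on_pderiv j smooth_w) Ux).
rewrite (hesC oU i k (smooth_on_pderiv j smooth_f) Ux).
rewrite (hesC oU i k smooth_w Ux) (hesC oU i k smooth_f Ux) (hesC oU j k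
  smooth_w Ux).
generalize_atoms; lra.
Qed.

(** This is half the derivative of the isotropy condition. *)
Lemma hes_f_null x i : U x -> dot (hes f x i) (dif f x) = 0.
Proof.
move=> Ux.
have g0 : has_gradient (fun y => dot (dif f y) (dif f y)) x (fun=> 0).
  apply: (has_gradient_eq_on oU Ux _ (has_gradient_cst 0 x)) => y Uy.
  by rewrite null.
have /= := has_gradient_unique (dot_dif_gradient eps smooth_f smooth_f Ux) g0 i.
by rewrite [X in _ + X]dotC; lra.
Qed.

(** The trace of the Hessian of [w] and the contraction of the soliton equation
    with [df] give two expressions of [pure_trace] in terms of [c], which
    determine [c]. *)
Lemma soliton_structure x i0 : U x -> dif f x i0 != 0 ->
  let c := hess_coef eps w x + lambda / (2 * (m%:R - 1) * w x) in
  [/\ exists b, null_structure eps w f x c b,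
      forall k, dif pure_trace x k = c * dif f x k &
      pure_trace x = - dot (dif w x) (dif f x) - (m%:R - 2) * c].
Proof.
move=> Ux f0 c0; have wx := w0 Ux.
have m10 : m%:R - 1 != 0 :> R.
  by rewrite subr_eq0 (eqr_nat R m 1) gtn_eqF // ltnW.
have [c [b [wE pE]]] := null_codazzi_structure eps2 m2 f0 (null Ux)
  (fun i j => hesC oU i j smooth_w Ux) (soliton_codazzi Ux).
have lapE : lap w x = m%:R * c.
  have -> : lap w x = c * (\sum_i eps i * eta i i) + b * dot (dif f x) (dif f
    x).
    rewrite /lap /dot !mulr_sumr -big_split; apply: eq_bigr => i _ /=.
    by rewrite wE; ring.
  by rewrite null // trace_eta // mulr0 addr0 mulrC.
have trace_c : pure_trace x = - dot (dif w x) (dif f x) - (m%:R - 2) * c.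
  have : \sum_i eps i * dif f x i * ((m%:R - 2) * hes w x i i0
     + w x * hes f x i i0
     + (dif w x i * dif f x i0 + dif w x i0 * dif f x i)
     + pure_trace x * eta i i0) = 0.
    by rewrite big1 // => i _; rewrite cleared_soliton // mulr0.
  have -> : \sum_i eps i * dif f x i * ((m%:R - 2) * hes w x i i0
     + w x * hes f x i i0
     + (dif w x i * dif f x i0 + dif w x i0 * dif f x i)
     + pure_trace x * eta i i0) =
     ((m%:R - 2) * c + pure_trace x) * dot (dif f x) (eta^~ i0)
     + ((m%:R - 2) * b * dif f x i0 + dif w x i0) * dot (dif f x) (dif f x)
     + w x * dot (hes f x i0) (dif f x) + dif f x i0 * dot (dif w x) (dif f x).
    rewrite /dot !mulr_sumr -!big_split; apply: eq_bigr => i _ /=.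
    by rewrite wE (hesC oU i i0 smooth_f Ux); ring.
  rewrite null // hes_f_null // dot_eta // => E.
  have : dif f x i0 * (pure_trace x + dot (dif w x) (dif f x) + (m%:R - 2) * c)
    = 0 by lra.
  by move/eqP; rewrite mulf_eq0 (negPf f0) /= => /eqP; lra.
have c0E : c = c0.
  have : 2 * (m%:R - 1) * c = (m%:R - 1) * dot (dif w x) (dif w x) / w x +
    lambda / w x.
    by have := trace_c; rewrite {1}/pure_trace lapE; lra.
  move=> E; rewrite /c0 /hess_coef.
  apply: (mulfI (_ : 2 * (m%:R - 1) != 0)); first by rewrite mulf_neq0.
  by rewrite E; field; rewrite wx m10.
split; rewrite -?c0E //; exists b; split; [exact: null | exact: wE | move=> i
  j].
apply: (mulfI wx); have := cleared_soliton i j Ux; rewrite wE trace_c => E.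
transitivity (- ((m%:R - 2) * (c * eta i j + b * dif f x i * dif f x j)
  + (dif w x i * dif f x j + dif w x j * dif f x i)
  + (- dot (dif w x) (dif f x) - (m%:R - 2) * c) * eta i j)); first by lra.
by generalize_atoms; field.
Qed.

(** The formula for [pure_trace] in soliton_structure holds near [x] and may be
    differentiated there; its derivative is [c df] only if [lambda = 0]. *)
Lemma soliton_steady x i0 : U x -> dif f x i0 != 0 -> lambda = 0.
Proof.
move=> Ux f0; have wx := w0 Ux.
have m10 : m%:R - 1 != 0 :> R.
  by rewrite subr_eq0 (eqr_nat R m 1) gtn_eqF // ltnW.
pose W := U `&` [set y | dif f y i0 != 0].
have oW : open W by apply: open_neq0 => //; exact: smooth_dif.
have [[b str] dpsi _] := soliton_structure Ux f0.
set c := _ + _ in str dpsi.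
have gw := dif_gradient smooth_w Ux.
have gt := dot_dif_wf_gradient eps2 smooth_w smooth_f w0 Ux str.
have gq := hess_coef_gradient eps2 smooth_w w0 Ux str.
have kw0 : 2 * (m%:R - 1) * w x != 0 by rewrite !mulf_neq0.
have gk := has_gradientM (has_gradient_cst lambda x) (has_gradientV kw0
  (has_gradientM (has_gradient_cst (2 * (m%:R - 1)) x) gw)).
have gpsi := has_gradientB (has_gradientN gt)
  (has_gradientM (has_gradient_cst (m%:R - 2) x) (has_gradientD gq gk)).
have gpsi' := has_gradient_eq_on (k := pure_trace) oW (conj Ux f0) _ gpsi.
have {gpsi'}[y [Uy fy]|_ /(_ i0) E] := gpsi'.
  by have [_ _ ->] := soliton_structure Uy fy.
move: E; rewrite -[pderiv _ _ _]/(dif pure_trace x i0) dpsi.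
have -> : hess_coef eps w x = c - lambda / (2 * (m%:R - 1) * w x) by rewrite /c
  addrK.
move: c {str dpsi gt gq gk gpsi} => c E.
have : dif f x i0 * lambda = 0.
  (* The terms with b and with the derivatives of w cancel in L, and only
     f_i0 * lambda / ((m - 1) w) remains. *)
  move: E => /eqP; rewrite -subr_eq0 => /eqP; set L := (X in X = 0) => L0.
  transitivity ((m%:R - 1) * w x * L); last by rewrite L0 mulr0.
  rewrite /L; move: {L L0} f0; generalize_atoms => _.
  by field; rewrite m10 wx.
by move/eqP; rewrite mulf_eq0 (negPf f0) => /eqP.
Qed.

End SolitonEquation.

(** * Geometry of a metric conformal to the Minkowski metric *)

Section ConformallyFlat.
Variables (R : realType) (m : nat).
Variables (U : set 'rV[R]_m) (G : 'rV[R]_m -> 'M[R]_m) (w : 'rV[R]_m -> R).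
Hypotheses (oU : open U) (smooth_w : smooth_on U w).
Hypothesis w0 : forall x, U x -> w x != 0.
Hypothesis GE : forall x, U x -> G x = (w x ^+ 2)^-1 *: Defs.minkowski R m.

Definition sign (i : 'I_m) : R := if val i == 0%N then -1 else 1.

Local Notation eps := sign.
Local Notation eta := (eta sign).
Local Notation dot := (dot sign).
Local Notation lap := (lap sign).

Lemma sign2 i : eps i * eps i = 1.
Proof. by rewrite /eps; case: ifP; rewrite ?mulrNN mulr1. Qed.

Lemma eps_eta i j : eps i * eta i j = (i == j)%:R.
Proof. by rewrite /eta mulrA sign2 mul1r. Qed.

Lemma minkowskiE i j : Defs.minkowski R m i j = eta i j.
Proof. by rewrite !mxE /eta /eps mulr_natr. Qed.

Lemma minkowski2 : Defs.minkowski R m *m Defs.minkowski R m = 1%:M.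
Proof.
apply/matrixP => i j; rewrite !mxE.
under eq_bigr do rewrite !minkowskiE.
rewrite (eq_bigr (fun k => (eps i * eps k * (k == j)%:R) * (k == i)%:R)).
  rewrite sum_delta; case: eqP => [->|_]; last by rewrite mulr0.
  by rewrite mulr1 sign2.
by move=> k _; rewrite /eta [i == k]eq_sym; ring.
Qed.

Lemma invmx_scale_minkowski (a : R) : a != 0 ->
  invmx (a *: Defs.minkowski R m) = a^-1 *: Defs.minkowski R m.
Proof.
move=> a0; have AB : (a *: Defs.minkowski R m) *m (a^-1 *: Defs.minkowski R m)
  = 1%:M.
  by rewrite -scalemxAl -scalemxAr scalerA minkowski2 mulfV // scale1r.
have [uA _] := mulmx1_unit AB.
by rewrite -[LHS]mulmx1 -AB mulmxA mulVmx // mul1mx.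
Qed.

Lemma inner_conformal x X Y : U x ->
  inner (G x) X Y = (w x ^+ 2)^-1 * dot (X 0) (Y 0).
Proof.
move=> Ux; rewrite /inner GE // -scalemxAr -scalemxAl mxE; congr (_ * _).
rewrite !mxE; apply: eq_bigr => k _; rewrite !mxE; congr (_ * _).
rewrite -[RHS](sum_delta (fun i => eps i * X 0 i)); apply: eq_bigr => i _.
by rewrite minkowskiE /eta; ring.
Qed.

Lemma invmxE x k l : U x -> invmx (G x) k l = w x ^+ 2 * eta k l.
Proof.
move=> Ux; rewrite GE // invmx_scale_minkowski; last first.
  by rewrite invr_neq0 // expf_neq0 // w0.
by rewrite mxE invrK minkowskiE.
Qed.

Lemma pderiv_metric x i j l : U x ->
  pderiv i (fun y => G y j l) x = - 2 * dif w x i / w x ^+ 3 * eta j l.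
Proof.
move=> Ux; have gw := dif_gradient smooth_w Ux; have wx := w0 Ux.
have ww : w x * w x != 0 by rewrite mulf_neq0.
have g1 := has_gradientM (has_gradientV ww (has_gradientM gw gw))
  (has_gradient_cst (eta j l) x).
have [y Uy|_ ->] := has_gradient_eq_on (k := fun y => G y j l) oU Ux _ g1.
  by rewrite GE // mxE minkowskiE -expr2.
by generalize_atoms; field.
Qed.

Lemma christoffelE x i j k : U x -> christoffel G i j k x =
  - ((k == i)%:R * dif w x j + (k == j)%:R * dif w x i
     - eps k * eta i j * dif w x k) / w x.
Proof.
move=> Ux; have wx := w0 Ux; rewrite /christoffel.
rewrite (eq_bigr (fun l => - (2 / w x) * (eps k * (eta j l * dif w x i
    + eta i l * dif w x j - eta i j * dif w x l)) * (l == k)%:R)).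
  rewrite sum_delta -!eps_eta ![eta k _]etaC.
  by generalize_atoms; field.
move=> l _; rewrite !pderiv_metric // invmxE // /eta [k == l]eq_sym.
rewrite -/(eta j l) -/(eta i l) -/(eta i j).
by case: (l == k); generalize_atoms; field.
Qed.

Lemma covdE x i X k : U x -> covd G i X x 0 k =
  pderiv i (fun y => X y 0 k) x
  - (dif w x i * X x 0 k + (k == i)%:R * (\sum_j dif w x j * X x 0 j)
     - eps k * dif w x k * (eps i * X x 0 i)) / w x.
Proof.
move=> Ux; rewrite mxE; congr (_ + _); have wx := w0 Ux.
rewrite -[X in dif w x i * X](sum_delta (X x 0)).
rewrite -[X in eps i * X](sum_delta (X x 0)).
rewrite !(mulr_sumr, mulr_suml) -sumrN -!big_split /= mulr_suml -sumrN.
apply: eq_bigr => j _; rewrite christoffelE // /eta [k == j]eq_sym [i ==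
  j]eq_sym.
by generalize_atoms; field.
Qed.

Lemma gradE h x k : U x -> grad G h x 0 k = w x * w x * (eps k * dif h x k).
Proof.
move=> Ux; rewrite mxE -[eps k * _](sum_delta (fun l => eps k * dif h x l)).
rewrite mulr_sumr; apply: eq_bigr => l _; rewrite invmxE // /eta [k == l]eq_sym.
by rewrite -/(dif h x l); ring.
Qed.

Lemma inner_grad h x : U x ->
  inner (G x) (grad G h x) (grad G h x) = w x ^+ 2 * dot (dif h x) (dif h x).
Proof.
move=> Ux; have wx := w0 Ux; rewrite inner_conformal // /dot !mulr_sumr.
apply: eq_bigr => i _; rewrite !gradE //.
transitivity (w x ^+ 2 * (eps i * dif h x i * dif h x i) * (eps i * eps i)).
  by generalize_atoms; field.
by rewrite sign2 mulr1.
Qed.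

Lemma hessE h x i j : smooth_on U h -> U x -> hess G h x i j =
  hes h x i j + (dif w x i * dif h x j + dif w x j * dif h x i
                 - dot (dif w x) (dif h x) * eta i j) / w x.
Proof.
move=> sh Ux; have wx := w0 Ux; have gw := dif_gradient smooth_w Ux.
rewrite mxE inner_conformal //.
have -> : dot (covd G i (grad G h) x 0) (basis_vec R j 0) =
    eps j * covd G i (grad G h) x 0 j.
  rewrite /dot -[RHS](sum_delta (fun l => eps l * covd G i (grad G h) x 0 l)).
  by apply: eq_bigr => l _; rewrite [basis_vec R j 0 l]mxE eqxx.
have gG : has_gradient (fun y => grad G h y 0 j) x (fun l =>
    eps j * (2 * w x * dif w x l * dif h x j + w x * w x * hes h x l j)).
  have g1 := has_gradientM (has_gradientM gw gw) (has_gradientM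
    (has_gradient_cst (eps j) x) (hes_gradient j sh Ux)).
  have := has_gradient_eq_on (k := fun y => grad G h y 0 j) oU Ux _ g1.
  move=> /(_ (fun y Uy => esym (gradE h j Uy))) g2.
  by apply: has_gradient_eqd g2 _ => l; generalize_atoms; ring.
rewrite covdE // gG.2 !gradE //.
have -> : \sum_l dif w x l * grad G h x 0 l =
    w x * w x * dot (dif w x) (dif h x).
  by rewrite mulr_sumr; apply: eq_bigr => l _; rewrite gradE //; ring.
have e2 l := sign2 l.
rewrite (_ : eps j * _ = eps j * eps j * (2 * w x * dif w x i * dif h x j
    + w x * w x * hes h x i j) - (eps j * eps j * dif w x i * w x * w x * dif h
      x j
    + eta i j * w x * w x * dot (dif w x) (dif h x)
    - eps j * eps j * (eps i * eps i) * dif w x j * w x * w x * dif h x i) / w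
      x).
  by rewrite !e2; generalize_atoms; field.
by rewrite [eta i j]etaC /eta; generalize_atoms; field.
Qed.

(** The Schouten tensor of [w^-2 eta]; the Weyl tensor vanishes, so that it
    determines the curvature. *)
Definition schouten x i j : R :=
  hes w x i j / w x - dot (dif w x) (dif w x) / (2 * w x ^+ 2) * eta i j.

(** The covariant derivatives of the coordinate fields are the Christoffel
    symbols [X]; differentiating them once more with covdE and antisymmetrising
    leaves the second derivatives of [w] and a multiple of [eta]. *)
Lemma riemE x i j k l : U x -> riem G i j k x 0 l =
  schouten x j k * (l == i)%:R - schouten x i k * (l == j)%:R
  + eps l * (eta j k * schouten x i l - eta i k * schouten x j l).
Proof.
move=> Ux; have wx := w0 Ux; have gw := dif_gradient smooth_w Ux.
have gwi p := hes_gradient p smooth_w Ux.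
pose X j y p := - (((p == j)%:R * dif w y k + (p == k)%:R * dif w y j
     - eps p * eta j k * dif w y p) / w y).
have covd_basis y a p : U y -> covd G a (fun=> basis_vec R k) y 0 p = X a y p.
  move=> Uy; rewrite covdE // (has_gradient_cst _ y).2 /X add0r !mxE eqxx /=.
  rewrite (eq_bigr (fun q => dif w y q * (q == k)%:R)).
    by rewrite sum_delta /eta; congr (- (_ / _)); ring.
  by move=> q _; rewrite mxE eqxx.
have gX a p : has_gradient (fun y => covd G a (fun=> basis_vec R k) y 0 p) x
    (fun q => - ((p == a)%:R * hes w x q k + (p == k)%:R * hes w x q a
       - eps p * eta a k * hes w x q p) / w x - X a x p * dif w x q / w x).
  have g1 := has_gradientN (has_gradientM (has_gradientB (has_gradientD
    (has_gradientM (has_gradient_cst (p == a)%:R x) (gwi k))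
    (has_gradientM (has_gradient_cst (p == k)%:R x) (gwi a)))
    (has_gradientM (has_gradient_cst (eps p * eta a k) x) (gwi p)))
    (has_gradientV wx gw)).
  have g2 := has_gradient_eq_on
    (k := fun y => covd G a (fun=> basis_vec R k) y 0 p) oU Ux _ g1.
  apply: has_gradient_eqd (g2 _) _ => [y Uy|q]; first by rewrite covd_basis.
  by rewrite /X; generalize_atoms; field.
have sumX a : \sum_p dif w x p * X a x p =
    - (2 * dif w x a * dif w x k - eta a k * dot (dif w x) (dif w x)) / w x.
  rewrite (_ : 2 * dif w x a * dif w x k =
    \sum_p (dif w x p * dif w x k * (p == a)%:R +
            dif w x p * dif w x a * (p == k)%:R)); last first.
    by rewrite big_split /= !(sum_delta (fun p => dif w x p * _)); ring.
  rewrite /dot mulr_sumr -sumrB -sumrN mulr_suml; apply: eq_bigr => p _.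
  by rewrite /X; generalize_atoms; field.
have epsX a b : eps b * X a x b = - (eta a b * dif w x k + eta b k * dif w x a
    - eta a k * dif w x b) / w x.
  transitivity (- ((eps b * (b == a)%:R * dif w x k + eps b * (b == k)%:R * dif
    w x a
    - eps b * eps b * eta a k * dif w x b) / w x)).
    by rewrite /X; generalize_atoms; field.
  rewrite sign2 -![eps b * _%:R]/(eta _ _) [eta b a]etaC.
  by generalize_atoms; field.
have step a b : covd G a (covd G b (fun=> basis_vec R k)) x 0 l =
   - ((l == b)%:R * hes w x a k + (l == k)%:R * hes w x a b
       - eps l * eta b k * hes w x a l) / w x - X b x l * dif w x a / w x
   - (dif w x a * X b x l + (l == a)%:R * (- (2 * dif w x b * dif w x k
        - eta b k * dot (dif w x) (dif w x)) / w x)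
     - eps l * dif w x l * (- (eta b a * dif w x k + eta a k * dif w x b
    - eta b k * dif w x a) / w x)) / w x.
  rewrite covdE // (gX b l).2 !covd_basis // epsX.
  by rewrite (eq_bigr _ (fun p _ => congr1 _ (covd_basis x b p Ux))) sumX.
rewrite mxE [X in _ + X]mxE !step (hesC oU j i smooth_w Ux) [eta j i]etaC.
rewrite /X /schouten.
have -> : eps l * (eta j k * (hes w x i l / w x -
   dot (dif w x) (dif w x) / (2 * w x ^+ 2) * eta i l) -
   eta i k * (hes w x j l / w x -
   dot (dif w x) (dif w x) / (2 * w x ^+ 2) * eta j l)) =
  eta j k * (eps l * hes w x i l / w x -
   dot (dif w x) (dif w x) / (2 * w x ^+ 2) * (l == i)%:R) -
   eta i k * (eps l * hes w x j l / w x -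
   dot (dif w x) (dif w x) / (2 * w x ^+ 2) * (l == j)%:R).
  by rewrite -!eps_eta ![eta l _]etaC; generalize_atoms; field.
by generalize_atoms; field.
Qed.

(** Trace of riemE: [(m - 2)] times the Schouten tensor plus its [eta]-trace
    times [eta]. *)
Lemma ricciE x j k : U x -> ricci G x j k =
  (m%:R - 2) * hes w x j k / w x
  + (lap w x / w x - (m%:R - 1) * dot (dif w x) (dif w x) / w x ^+ 2) * eta j k.
Proof.
move=> Ux; have wx := w0 Ux; rewrite mxE.
have trE : \sum_i eps i * schouten x i i =
    lap w x / w x - m%:R * dot (dif w x) (dif w x) / (2 * w x ^+ 2).
  rewrite -(trace_eta sign2) /lap !mulr_suml -sumrB; apply: eq_bigr => i _.
  by rewrite /schouten; generalize_atoms; field.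
have sumE (S : 'I_m -> 'I_m -> R) : \sum_i (S j k * (i == i)%:R
      - S i k * (i == j)%:R + eps i * (eta j k * S i i - eta i k * S j i)) =
    (m%:R - 1) * S j k + (eta j k * (\sum_i eps i * S i i) - S j k).
  rewrite (eq_bigr (fun i => S j k - S i k * (i == j)%:R
    + (eta j k * (eps i * S i i) - S j i * (i == k)%:R))) => [|i _].
    rewrite !big_split !sumrN /= !sum_delta -mulr_sumr sumr_const card_ord.
    by rewrite -mulr_natl; ring.
  by rewrite eqxx mulr1 -(eps_eta i k); ring.
rewrite (eq_bigr _ (fun i _ => riemE i j k i Ux)) sumE trE /schouten.
by generalize_atoms; field.
Qed.

End ConformallyFlat.

(** * A parallel null vector field *)

Section ParallelField.
Variables (R : realType) (m : nat).
Variables (U : set 'rV[R]_m) (G : 'rV[R]_m -> 'M[R]_m) (w f : 'rV[R]_m -> R).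
Hypotheses (oU : open U) (smooth_w : smooth_on U w) (smooth_f : smooth_on U f).
Hypothesis w0 : forall x, U x -> w x != 0.
Hypothesis GE : forall x, U x -> G x = (w x ^+ 2)^-1 *: Defs.minkowski R m.

Local Notation eps := (@sign R m).
Local Notation eta := (eta eps).
Local Notation dot := (dot eps).

Hypothesis structure_f : forall x, U x ->
  exists b, null_structure eps w f x (hess_coef eps w x) b.

Variables (x0 : 'rV[R]_m) (j0 : 'I_m).

Local Notation killing_taylor := (killing_taylor eps w f x0 j0).

Lemma smooth_hess_coef : smooth_on U (hess_coef eps w).
Proof.
apply: smooth_onM => //; first exact: smooth_dot.
apply: smooth_onV => // [|y Uy]; last by rewrite mulf_neq0 ?w0.
by apply: smooth_onM => //; exact: smooth_on_cst.
Qed.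

Lemma smooth_offset i : smooth_on U (fun y => offset x0 y i).
Proof. by apply: smooth_onB => //; [exact: smooth_on_coord | exact:
  smooth_on_cst]. Qed.

Lemma smooth_killing_d2 i : smooth_on U (fun y => killing_d2 eps w f y i).
Proof.
have sq := smooth_hess_coef.
apply: smooth_onB => //; apply: smooth_onM => //; try exact: smooth_dif.
  exact: smooth_dot.
exact: smooth_onM.
Qed.

Lemma smooth_killing_d1 i : smooth_on U (fun y => killing_d1 eps w f j0 y i).
Proof.
apply: smooth_onM => //; apply: smooth_onD => //.
  by apply: smooth_onB => //; apply: smooth_onM => //; exact: smooth_dif.
by apply: smooth_onM => //; [exact: smooth_dot | exact: smooth_on_cst].
Qed.

Lemma smooth_killing_taylor : smooth_on U killing_taylor.
Proof.
have sp := smooth_offset; have ss := smooth_killing_d2.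
apply: smooth_onB => //; last first.
  apply: smooth_onM => //; first exact: smooth_on_cst.
  apply: smooth_onM => //; apply: smooth_on_sum => // i.
  by apply: smooth_onM => //; apply: smooth_onM => //; exact: smooth_on_cst.
apply: smooth_onD => //; last first.
  apply: smooth_onM => //; last by apply: smooth_on_sum => // i;
    exact: smooth_onM.
  by apply: smooth_onM => //; exact: smooth_on_cst.
apply: smooth_onB => //; last first.
  by apply: smooth_on_sum => // i; apply: smooth_onM => //;
    exact: smooth_killing_d1.
by apply: smooth_onM => //; [exact: smooth_onM | exact: smooth_dif].
Qed.

Hypothesis killing_taylor0 : forall x, U x -> killing_taylor x != 0.
Hypothesis df0 : forall x, U x -> exists i, dif f x i != 0.

Definition parallel_field (x : 'rV[R]_m) : 'rV[R]_m :=
  \row_k ((killing_taylor x)^-1 * (w x * w x * (eps k * dif f x k))).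

Lemma smooth_parallel_field : smooth_row_on U parallel_field.
Proof.
move=> k; apply: (@smooth_on_eq _ _ _ (fun y => (killing_taylor y)^-1 *
  (w y * w y * (eps k * dif f y k)))) => // [y _|]; first by rewrite mxE.
apply: smooth_onM => //; first by apply: smooth_onV => //;
  exact: smooth_killing_taylor.
apply: smooth_onM => //; first exact: smooth_onM.
by apply: smooth_onM => //; [exact: smooth_on_cst | exact: smooth_dif].
Qed.

Lemma inner_parallel_field x X : U x ->
  inner (G x) X (parallel_field x) = (killing_taylor x)^-1 * \sum_i X 0 i * dif
    f x i.
Proof.
move=> Ux; rewrite (inner_conformal GE) // /dot !mulr_sumr.
have wx := w0 Ux; have p0 := killing_taylor0 Ux; apply: eq_bigr => i _;
  rewrite mxE.
transitivity (eps i * eps i * ((killing_taylor x)^-1 * (X 0 i * dif f x i))).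
  by move: (killing_taylor x) p0 => P P0; generalize_atoms; field;
    rewrite P0 wx.
by rewrite sign2 mul1r.
Qed.

Lemma parallel_field_neq0 x : U x -> parallel_field x != 0.
Proof.
move=> Ux; have [i fi] := df0 Ux; apply/eqP => /rowP/(_ i)/eqP; rewrite !mxE.
apply/negP; rewrite !mulf_neq0 // ?w0 // ?invr_neq0 ?killing_taylor0 //.
by rewrite /sign; case: ifP; rewrite ?oppr_eq0 oner_neq0.
Qed.

Lemma parallel_field_null x : U x ->
  inner (G x) (parallel_field x) (parallel_field x) = 0.
Proof.
move=> Ux; have [b [ff _ _]] := structure_f Ux.
rewrite inner_parallel_field //.
transitivity ((killing_taylor x)^-1 * ((killing_taylor x)^-1 * (w x * w x) *
  dot (dif f x) (dif f x))); last by rewrite ff !mulr0.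
congr (_ * _); rewrite /dot mulr_sumr; apply: eq_bigr => i _; rewrite mxE.
by move: (killing_taylor x) => P; generalize_atoms; ring.
Qed.

(** The factor [1 / killing_taylor] has logarithmic derivative [a df], which
    compensates [nabla grad f = - a df.grad f]. *)
Lemma parallel_field_parallel x i : U x -> covd G i parallel_field x = 0.
Proof.
move=> Ux; have [b str] := structure_f Ux; have [ff _ fE] := str.
have wx := w0 Ux; have p0 := killing_taylor0 Ux.
have gw := dif_gradient smooth_w Ux.
apply/rowP => k; rewrite (covdE oU smooth_w w0 GE) // [RHS]mxE.
have gp := killing_taylor_gradient (@sign2 R m) smooth_w smooth_f w0 x0 j0 Ux
  str.
have gK := has_gradientM (has_gradientV p0 gp) (has_gradientM
  (has_gradientM gw gw) (has_gradientM (has_gradient_cst (eps k) x)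
  (hes_gradient k smooth_f Ux))).
have gK' := has_gradient_eq_on (k := fun y => parallel_field y 0 k) oU Ux _ gK.
rewrite (gK' _).2; last by move=> y _; rewrite mxE.
have -> : \sum_j dif w x j * parallel_field x 0 j =
    (killing_taylor x)^-1 * (w x * w x) * dot (dif w x) (dif f x).
  rewrite mulr_sumr; apply: eq_bigr => j _; rewrite mxE.
  by move: (killing_taylor x) => P; generalize_atoms; ring.
rewrite !mxE fE -eps_eta [eta k i]etaC.
rewrite (_ : eps i * (_ * (_ * (eps i * _))) =
  eps i * eps i * ((killing_taylor x)^-1 * (w x * w x * dif f x i)));
    last first.
  by move: (killing_taylor x) => P; generalize_atoms; ring.
rewrite sign2; move: (killing_taylor x) p0 => P P0.
by generalize_atoms; field; rewrite P0 wx.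
Qed.

Lemma innerBl (A : 'M[R]_m) (a b : R) X Y W :
  inner A (a *: X - b *: Y) W = a * inner A X W - b * inner A Y W.
Proof. by rewrite /inner !mulmxBl -!scalemxAl !mxE. Qed.

(** The Schouten tensor is a multiple of [df.df], hence the curvature operator
    of [(i, j)] is [f_j A_i - f_i A_j]; it vanishes when both arguments are
    annihilated by [df]. *)
Lemma curvature_orthogonal x (X Y Z W : 'rV[R]_m) : U x ->
  \sum_i X 0 i * dif f x i = 0 -> \sum_i Y 0 i * dif f x i = 0 ->
  curvature G x X Y Z W = 0.
Proof.
move=> Ux Xf Yf; have [b [_ wE _]] := structure_f Ux; have wx := w0 Ux.
pose A i k : 'rV[R]_m := b / w x *: \row_l
  (dif f x k * (l == i)%:R - eta i k * (eps l * dif f x l)).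
have schoutenE i j : schouten w x i j = b / w x * (dif f x i * dif f x j).
  by rewrite /schouten wE /hess_coef; generalize_atoms; field.
have riemA i j k : riem G i j k x = dif f x j *: A i k - dif f x i *: A j k.
  apply/rowP => l; rewrite (riemE oU smooth_w w0 GE) // !schoutenE !mxE.
  by move: (b / w x) => B; generalize_atoms; ring.
pose a i k := inner (G x) (A i k) W.
rewrite /curvature (eq_bigr (fun i => \sum_j (Y 0 j * dif f x j) *
    (\sum_k X 0 i * Z 0 k * a i k) - \sum_j (X 0 i * dif f x i) *
    (\sum_k Y 0 j * Z 0 k * a j k))); last first.
  move=> i _; rewrite -sumrB; apply: eq_bigr => j _; rewrite !mulr_sumr -sumrB.
  by apply: eq_bigr => k _; rewrite riemA innerBl /a; ring.
rewrite sumrB [X in _ - X]exchange_big /= !big1 ?subr0 // => i _.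
  by rewrite -mulr_suml Xf mul0r.
by rewrite -mulr_suml Yf mul0r.
Qed.

Lemma pp_wave_parallel_field : pp_wave_on G U.
Proof.
exists parallel_field; split.
- exact: smooth_parallel_field.
- by move=> x Ux; split; [exact: parallel_field_neq0 | exact:
  parallel_field_null].
- by move=> x i Ux; exact: parallel_field_parallel.
have orth x X : U x -> inner (G x) X (parallel_field x) = 0 ->
    \sum_i X 0 i * dif f x i = 0.
  move=> Ux; rewrite inner_parallel_field // => /eqP.
  by rewrite mulf_eq0 invr_eq0 (negPf (killing_taylor0 Ux)) => /eqP.
by move=> x X Y Z W Ux /(orth x X Ux) Xf /(orth x Y Ux) Yf;
  exact: curvature_orthogonal.
Qed.

End ParallelField.

(** * Restriction of charts *)

Section Restriction.
Variables (R : realType) (m : nat) (T : topologicalType) (c : chart R m T).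
Variables (V : set 'rV[R]_m) (oV : open V).

Let rdom : set T := [set p | dom c p /\ V (phi c p)].
Let rimg : set 'rV[R]_m := img c `&` V.

Lemma restrict_dom_open : open rdom.
Proof.
rewrite openE => p [cp Vp].
have cphi : {for p, continuous (phi c)} := phi_continuous cp.
exact: filterI (open_nbhs_nbhs (conj (@dom_open _ _ _ c) cp))
  (cphi _ (open_nbhs_nbhs (conj oV Vp))).
Qed.

Lemma restrict_phi_img p : rdom p -> rimg (phi c p).
Proof. by move=> [cp Vp]; split=> //; exact: phi_img. Qed.

Lemma restrict_psi_dom x : rimg x -> rdom (psi c x).
Proof. by move=> [cx Vx]; split; [exact: psi_dom | rewrite psiK]. Qed.

Definition restrict_chart : chart R m T :=
  Chart restrict_dom_open (openI (@img_open _ _ _ c) oV) restrict_phi_img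
    restrict_psi_dom
    (fun p cp => phiK (proj1 cp)) (fun x cx => psiK (proj1 cx))
    (fun p cp => phi_continuous (proj1 cp))
    (fun x cx => psi_continuous (proj1 cx)).

Lemma compatible_restrict d : compatible c d -> compatible restrict_chart d.
Proof.
move=> [cd dc]; split=> j; [apply: smooth_onS (cd j) | apply: smooth_onS (dc
  j)].
  by move=> x [[cx Vx] dx].
by move=> x [dx [cx Vx]].
Qed.

End Restriction.

Lemma atlas_restrict (R : realType) m (M : manifold R m) (c : chart R m M)
  (V : set 'rV[R]_m) (oV : open V) :
  atlas M c -> atlas M (restrict_chart c oV).
Proof.
move=> Mc; apply: atlas_maximal => d Md; apply: compatible_restrict.
exact: atlas_compatible.
Qed.

(** A chart and its restriction have a transition map that is the identity near
    each point of the smaller image, and their metrics are therefore equal. *)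
Lemma jacobian_near_id (R : realType) m (h : 'rV[R]_m -> 'rV[R]_m) x :
  (\forall y \near x, h y = y) -> 'J h x = 1%:M.
Proof.
move=> hid; have idh : {near x, id =1 h} by apply: filterS hid => y.
have dh : differentiable h x by exact: near_eq_differentiable idh _.
apply/row_matrixP => i; rewrite rowE -deriveEjacobian // row1.
by rewrite (near_eq_derive (g := id) _ hid) derive_id.
Qed.

Lemma metric_restrict (R : realType) m (M : manifold R m) (g : lorentz_metric M)
  (c : chart R m M) (V : set 'rV[R]_m) (oV : open V) x :
  atlas M c -> img c x -> V x -> g (restrict_chart c oV) x = g c x.
Proof.
move=> Mc cx Vx; set d := restrict_chart c oV.
have Md : atlas M d by exact: atlas_restrict.
have dx : overlap d c x by split; [split | exact: psi_dom].
rewrite (metric_change g Md Mc dx) jacobian_near_id.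
  by rewrite mul1mx trmx1 mulmx1 /transition /= psiK.
have := open_nbhs_nbhs (conj (@img_open _ _ _ c) cx).
by apply: filterS => y cy; rewrite /transition /= psiK.
Qed.

(** * Solitons in a conformally flat chart *)

Section FlatChart.
Variables (R : realType) (n : nat) (M : manifold R n.+2) (g : lorentz_metric M).
Variables (f : M -> R) (lambda : R) (c : chart R n.+2 M).
Variables (sigma : 'rV[R]_n.+2 -> R) (x0 : 'rV[R]_n.+2).
Hypotheses (n_ge1 : (1 <= n)%N) (soliton : gradient_ricci_soliton g f lambda).
Hypotheses (iso : isotropic g f) (Mc : atlas M c) (cx0 : img c x0).
Hypothesis smooth_sigma : smooth_on (img c) sigma.
Hypothesis flat : forall x, img c x ->
  g c x = expR (2 * sigma x) *: Defs.minkowski R n.+2.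
Hypothesis grad0 : grad (g c) (f \o psi c) x0 != 0.

Let w x := expR (- sigma x).
Let F := f \o psi c.

Local Notation eps := (@sign R n.+2).
Local Notation dot := (dot eps).
Local Notation eta := (eta eps).

Lemma factor_neq0 x : img c x -> w x != 0.
Proof. by move=> _; rewrite /w expR_eq0. Qed.

Lemma smooth_factor : smooth_on (img c) w.
Proof.
have oc := @img_open _ _ _ c; apply: smooth_on_expR => //; exact: smooth_onN.
Qed.

Lemma metric_factor x : img c x ->
  g c x = (w x ^+ 2)^-1 *: Defs.minkowski R n.+2.
Proof.
move=> cx; rewrite flat //; congr (_ *: _).
by rewrite /w -expRM_natl -expRN mulrN opprK.
Qed.

Lemma smooth_F : smooth_on (img c) F.
Proof. by case: soliton => sf _; exact: sf. Qed.

Lemma dif_F_neq0 : exists j, dif F x0 j != 0.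
Proof.
apply/existsP; apply: contraT; rewrite negb_exists => /forallP F0.
case/eqP: grad0; apply/rowP => k; rewrite mxE big1 ?mxE // => l _.
by have := F0 l; rewrite negbK => /eqP FL; rewrite -/(dif F x0 l) FL mulr0.
Qed.

Lemma null_F x : img c x -> dot (dif F x) (dif F x) = 0.
Proof.
move=> cx; have := iso Mc cx; rewrite /= (inner_grad factor_neq0 metric_factor)
  //.
by move/eqP; rewrite mulf_eq0 expf_eq0 /= (negPf (factor_neq0 cx)) => /eqP.
Qed.

Lemma soliton_F x : img c x -> forall i j,
  (n.+2%:R - 2) * hes w x i j / w x
  + (lap eps w x / w x - (n.+2%:R - 1) * dot (dif w x) (dif w x) / w x ^+ 2)
    * eta i j
  + (hes F x i j + (dif w x i * dif F x j + dif w x j * dif F x i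
       - dot (dif w x) (dif F x) * eta i j) / w x)
  = lambda / w x ^+ 2 * eta i j.
Proof.
move=> cx i j; case: soliton => _ /(_ _ Mc x cx) /matrixP/(_ i j).
have oc := @img_open _ _ _ c.
rewrite [LHS]mxE (hessE oc smooth_factor factor_neq0 metric_factor) //;
  last exact: smooth_F.
rewrite (ricciE oc smooth_factor factor_neq0 metric_factor) // addrC => ->.
by rewrite mxE metric_factor // mxE minkowskiE mulrA.
Qed.

Let n2 : (2 < n.+2)%N. Proof. by rewrite !ltnS. Qed.

Lemma flat_chart_steady : lambda = 0.
Proof.
have [j fj] := dif_F_neq0.
exact: (soliton_steady (@sign2 R n.+2) n2 (@img_open _ _ _ c) smooth_factor
  smooth_F
  factor_neq0 soliton_F null_F cx0 fj).
Qed.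

(** The neighbourhood is cut out by [dif F y j != 0], where the structure of the
    Hessians is available, and by the nonvanishing of [killing_taylor], whose
    value at the base point is [w^2 f_j]. *)
Lemma flat_chart_pp_wave : exists V (oV : open V), V x0 /\
  pp_wave_on (g (restrict_chart c oV)) (img c `&` V).
Proof.
have [j fj] := dif_F_neq0; have oc := @img_open _ _ _ c.
pose W := img c `&` [set y | dif F y j != 0].
have oW : open W by apply: open_neq0 => //; apply: smooth_dif; exact: smooth_F.
have Wc : W `<=` img c by move=> y [].
have sw := smooth_onS Wc smooth_factor; have sF := smooth_onS Wc smooth_F.
have w0 y (Wy : W y) := factor_neq0 (Wc y Wy).
have str y : W y -> exists b, null_structure eps w F y (hess_coef eps w y) b.
  move=> [cy fy]; have := soliton_structure (@sign2 R n.+2) n2 oc smooth_factor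
    smooth_F factor_neq0 soliton_F null_F cy fy.
  by rewrite flat_chart_steady mul0r addr0 => -[].
pose Q := killing_taylor eps w F x0 j.
pose V := W `&` [set y | Q y != 0].
have oV : open V by apply: open_neq0 => //; exact: smooth_killing_taylor.
have VW : V `<=` W by move=> y [].
exists V, oV; split.
  split=> //; rewrite /= /Q /killing_taylor.
  have offset0 i : offset x0 x0 i = 0 by rewrite /offset subrr.
  have dot0 : dot (offset x0 x0) (offset x0 x0) = 0.
    by apply: big1 => i _; rewrite offset0 mulr0.
  rewrite offset0 dot0 !big1 => [|i _|i _]; rewrite ?offset0 ?mul0r ?mulr0 //.
  by rewrite !(subr0, addr0) !mulf_neq0 // w0.
have -> : img c `&` V = V by apply/setIidPr => y /VW /Wc.
apply: (@pp_wave_parallel_field R n.+2 V _ w F oV _ _ _ _ _ x0 j).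
- exact: smooth_onS VW sw.
- exact: smooth_onS VW sF.
- by move=> y /VW /w0.
- by move=> y Vy; rewrite metric_restrict ?metric_factor //; exact/Wc/VW.
- by move=> y /VW /str.
- by move=> y [].
- by move=> y /VW[_ fy]; exists j.
Qed.

End FlatChart.


Theorem lemma10 (R : realType) (n : nat) (n_ge1 : (1 <= n)%N)
  (M : manifold R n.+2) (g : lorentz_metric M) (f : M -> R) (lambda : R)
  (lcf : locally_conformally_flat g)
  (soliton : gradient_ricci_soliton g f lambda)
  (iso : isotropic g f)
  (nontrivial : exists p : M, grad_neq0 g f p) :
  lambda = 0 /\ (forall p : M, grad_neq0 g f p -> pp_wave_near g p).
Proof.
split.
  have [p gp] := nontrivial; have [c [sigma [Mc cp ss flat]]] := lcf p.
  exact: flat_chart_steady n_ge1 soliton iso Mc (phi_img cp) ss flat (gp c Mc cp).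
move=> p gp; have [c [sigma [Mc cp ss flat]]] := lcf p.
have [V [oV [Vp ppV]]] := flat_chart_pp_wave n_ge1 soliton iso Mc (phi_img cp)
  ss flat (gp c Mc cp).
by exists (restrict_chart c oV); split=> //; exact: atlas_restrict.
Qed.
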